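(* Let $\mathcal{C}=(S,\Delta,r)$ be a semimatroid with a fixed linear order on $S$. Then the broken circuit complex $BC(\mathcal{C})$ is vertex-decomposable, $f(BC(\mathcal{C}),q)=q^{r_{\mathcal{C}}}\,T_{\mathcal{C}}\!\left(\frac{q+1}{q},0\right)$, and $BC(\mathcal{C})$ is homotopy equivalent to a wedge of $T_{\mathcal{C}}(0,0)$ spheres of dimension $r_{\mathcal{C}}-1$.
   Context: A semimatroid is a triple $(S,\Delta,r)$ with $S$ finite, $\Delta$ a non-void simplicial complex over $S$, and $r:\Delta\to\mathbb{N}$ such that for all $\sigma,\tau\in\Delta$: (i) $0\le r(\sigma)\le|\sigma|$; (ii) $\sigma\subseteq\tau\Rightarrow r(\sigma)\le r(\tau)$; (iii) if $\sigma\cup\tau\in\Delta$ then $r(\sigma)+r(\tau)\ge r(\sigma\cup\tau)+r(\sigma\cap\tau)$; (iv) if $r(\sigma)=r(\sigma\cap\tau)$ then $\sigma\cup\tau\in\Delta$; (v) if $r(\sigma)<r(\tau)$ there is $y\in\tau\setminus\sigma$ with $\sigma\cup\{y\}\in\Delta$. A face $X\in\Delta$ is dependent if $r(X)<|X|$; a circuit is a minimal dependent face. Bases (maximal faces $X$ with $r(X)=|X|$) all have size $r_{\mathcal{C}}$. $T_{\mathcal{C}}(x,y)=\sum_{\sigma\in\Delta}(x-1)^{r_{\mathcal{C}}-r(\sigma)}(y-1)^{|\sigma|-r(\sigma)}$. A broken circuit is a set $\sigma\setminus\{\min\sigma\}$ for a circuit $\sigma$; $BC(\mathcal{C})$ is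 the subcomplex of faces of $\Delta$ containing no broken circuit. For a complex $\Gamma$, $f(\Gamma,q)=\sum_{\sigma\in\Gamma}q^{|\sigma|}$. Vertex-decomposability is in the sense of Provan–Billera. *)

(* Defs.v *)
From HB Require Import structures.
From mathcomp Require Import all_boot all_order all_algebra.
From mathcomp Require Import all_classical all_reals all_analysis homotopy.
Set Implicit Arguments.
Unset Strict Implicit.
Unset Printing Implicit Defensive.
Import Order.TTheory GRing.Theory Num.Theory.
Import numFieldNormedType.Exports.

(* A simplicial complex over a finite type S is represented by its set of
   faces G : {set {set S}}.  The void complex set0 (no face at all) and the
   empty complex [set set0] (whose only face is the empty set) are different. *)

Section SimplicialComplexes.
Context {S : finType}.
Implicit Types (G : {set {set S}}) (x : S).

Definition face_closed G :=
  forall s t : {set S}, t \in G -> s \subset t -> s \in G.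

Definition cdeletion G x : {set {set S}} := [set s in G | x \notin s]%SET.

Definition clink G x : {set {set S}} :=
  [set s : {set S} | (x \notin s) && (x |: s \in G)]%SET.

(* Dimension plus one. *)
Definition csize G : nat := \max_(s in G) #|s|.

Definition facet G (s : {set S}) : bool := maxset (fun t => t \in G) s.

Definition pure G := forall s, facet G s -> #|s| = csize G.

(* Provan and Billera's definition.  Simplices include the empty complex
   [set set0] = powerset set0; the void complex is vertex-decomposable by
   convention.  It is never a link or deletion in [vd_shed], so the convention
   only matters for the void complex itself. *)
Inductive vertex_decomposable : {set {set S}} -> Prop :=
| vd_void : vertex_decomposable finset.set0
| vd_simplex (A : {set S}) : vertex_decomposable (powerset A)
| vd_shed G x of
    face_closed G & pure G & [set x]%SET \in G
    & csize (cdeletion G x) = csize G & vertex_decomposable (cdeletion G x)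
    & (csize (clink G x)).+1 = csize G & vertex_decomposable (clink G x) :
    vertex_decomposable G.

Definition fpoly {A : comNzRingType} G (q : A) : A :=
  (\sum_(s in G) q ^+ #|s|)%R.

End SimplicialComplexes.

(* The rank function is total on {set S}; only its values on faces matter. *)
Record semimatroid (S : finType) := Semimatroid {
  faces : {set {set S}};
  rk : {set S} -> nat;
  faces_nonvoid : faces != finset.set0;
  faces_closed : face_closed faces;
  rk_le_card : forall s, s \in faces -> rk s <= #|s|;
  rk_mono : forall s t, s \in faces -> t \in faces ->
    s \subset t -> rk s <= rk t;
  rk_submodular : forall s t, s \in faces -> t \in faces ->
    s :|: t \in faces -> rk (s :|: t) + rk (s :&: t) <= rk s + rk t;
  rk_closure : forall s t, s \in faces -> t \in faces ->
    rk s = rk (s :&: t) -> s :|: t \in faces;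
  rk_augment : forall s t, s \in faces -> t \in faces ->
    rk s < rk t -> exists2 y, y \in t :\: s & y |: s \in faces
}.

Section Semimatroids.
Context {S : finType} (C : semimatroid S).

Definition dependent (s : {set S}) : bool :=
  (s \in faces C) && (rk C s < #|s|).

Definition circuit (s : {set S}) : bool := minset dependent s.

Definition independent (s : {set S}) : bool :=
  (s \in faces C) && (rk C s == #|s|).

Definition base (s : {set S}) : bool := maxset independent s.

(* The common size of all bases. *)
Definition rank : nat := \max_(B | base B) #|B|.

Definition tutte {A : comNzRingType} (x y : A) : A :=
  (\sum_(s in faces C)
     (x - 1) ^+ (rank - rk C s) * (y - 1) ^+ (#|s| - rk C s))%R.

End Semimatroids.

Section BrokenCircuits.
Context {disp : Order.disp_t} {S : finOrderType disp} (C : semimatroid S).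

Definition broken_circuit (b : {set S}) : bool :=
  [exists s : {set S}, circuit C s &&
    [exists m in s, [forall x in s, (m <= x)%O] && (b == s :\ m)]].

Definition BC : {set {set S}} :=
  [set s in faces C |
    [forall b : {set S}, broken_circuit b ==> ~~ (b \subset s)]]%SET.

End BrokenCircuits.

Local Open Scope classical_set_scope.
Local Open Scope ring_scope.

Section Homotopy.
Context (R : realType).

Definition homotopic {X Y : topologicalType} (f g : X -> Y) : Prop :=
  exists H : X * R -> Y,
    [/\ {within [set: X] `*` `[0%R, 1%R], continuous H},
        forall x, H (x, 0) = f x & forall x, H (x, 1) = g x].

Definition homotopy_equivalent (X Y : topologicalType) : Prop :=
  exists (f : X -> Y) (g : Y -> X),
    [/\ continuous f, continuous g,
        homotopic (g \o f) idfun & homotopic (f \o g) idfun].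

(* Formal convex combinations of vertices, supported on a face. *)
Definition geometric_realization {S : finType} (G : {set {set S}}) :
    set {ptws S -> R} :=
  [set t | [/\ forall v, 0 <= t v, \sum_v t v = 1 &
               [set v | t v != 0]%SET \in G]].

(* The unit sphere of R^n, of dimension n - 1; empty when n = 0. *)
Definition unit_sphere (n : nat) : set 'rV[R]_n :=
  [set x | \sum_i x 0 i ^+ 2 = 1].
Arguments unit_sphere n _ : clear implicits.

Lemma unit_sphere_pole n : unit_sphere n.+1 (delta_mx 0 0).
Proof.
rewrite /unit_sphere /= (bigD1 0) //= big1 => [|i /negbTE ni0].
  by rewrite mxE !eqxx expr1n addr0.
by rewrite mxE ni0 andbF expr0n.
Qed.

Definition sphere_basepoint n : unit_sphere n.+1 :=
  SigSub (mem_set (unit_sphere_pole n)).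

(* X is homotopy equivalent to a wedge of k spheres of dimension n - 1.  The
   library's [wedge] over an empty family is empty, whereas a wedge of zero
   spheres is a point; and the (-1)-sphere, having no base point, can only be
   the single term of a wedge, which is then the (-1)-sphere itself. *)
Definition htpy_wedge_of_spheres (X : topologicalType) (k n : nat) : Prop :=
  match k, n with
  | 0, _ => homotopy_equivalent X 'rV[R]_0
  | k'.+1, 0 => k' = 0%N /\ homotopy_equivalent X (unit_sphere 0)
  | k'.+1, n'.+1 =>
      homotopy_equivalent X (wedge (fun _ : 'I_k'.+1 => sphere_basepoint n'))
  end.

(* The void complex, which has no reduced homology, counts as contractible, that
   is, as a wedge of zero spheres of any dimension; the realization of the empty
   complex [set set0] is the (-1)-sphere. *)
Definition complex_htpy_wedge_of_spheres {S : finType} (G : {set {set S}})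
    (k n : nat) : Prop :=
  if G == finset.set0 then k = 0%N
  else htpy_wedge_of_spheres (geometric_realization G) k n.

End Homotopy.
Arguments unit_sphere R n _ : clear implicits.
Arguments geometric_realization R {S} G _.

(* Main.v *)
Require Import Defs.
From mathcomp Require Import all_boot all_order all_algebra.
From mathcomp Require Import zify ring lra.

(** Let [x] be the largest vertex.  If [x] is not a loop, the deletion and the
    link of [x] in [BC C] are the broken circuit complexes of the deletion and
    of the contraction of [C] at [x].  Vertex-decomposability and the formula
    for the face polynomial follow by induction; evaluation at [-1] turns the
    latter into the reduced Euler characteristic.

    A vertex-decomposable complex [G] has a set of facets of maximal size, the
    critical faces, whose removal leaves a complex that collapses to a point:
    for a shedding vertex [x] take the critical faces of the deletion and the
    joins of [x] with those of the link.  Let [G0] be the remaining complex.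
    The map from [|G|] to a wedge of spheres that sends [|G0|] to the base point
    and each open critical simplex onto a punctured sphere is a quotient map,
    since [|G|] is compact and the wedge is Hausdorff.  A homotopy of [|G|] that
    enlarges the critical simplices radially while contracting [|G0|] descends
    along it and yields a homotopy inverse.  The Euler characteristic counts
    the spheres. *)

Set Implicit Arguments.
Unset Strict Implicit.
Unset Printing Implicit Defensive.
Import Order.TTheory GRing.Theory Num.Theory.

Lemma in_cdeletion (S : finType) (G : {set {set S}}) x s :
  (s \in cdeletion G x) = (s \in G) && (x \notin s).
Proof. by rewrite inE. Qed.

Lemma in_clink (S : finType) (G : {set {set S}}) x s :
  (s \in clink G x) = (x \notin s) && (x |: s \in G).
Proof. by rewrite inE. Qed.

(** * Rank and bases of a semimatroid *)

Section Rank.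
Context {S : finType} (C : semimatroid S).
Implicit Types (s t : {set S}) (x y : S).
Local Notation r := (rk C).
Local Notation D := (faces C).

Lemma set0_faces : set0 \in D.
Proof.
have /set0Pn[s sD] := faces_nonvoid C.
exact: (faces_closed sD (sub0set s)).
Qed.

Lemma rk0 : r set0 = 0.
Proof. by apply/eqP; rewrite -leqn0 -(@cards0 S); apply: rk_le_card set0_faces. Qed.

Lemma rkU_le s t : s :|: t \in D -> r (s :|: t) <= r s + r t.
Proof.
move=> stD; have sD := faces_closed stD (subsetUl s t).
have tD := faces_closed stD (subsetUr s t).
exact: leq_trans (leq_addr _ _) (rk_submodular sD tD stD).
Qed.

Lemma rkU1_le s x : x |: s \in D -> r (x |: s) <= (r s).+1.
Proof.
move=> xsD; have := rkU_le xsD; have xD := faces_closed xsD (subsetUl _ _).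
by have := rk_le_card xD; rewrite cards1; lia.
Qed.

Lemma augment s t : s \in D -> t \in D -> r s < r t ->
  exists y, [/\ y \in t, y \notin s, y |: s \in D & r (y |: s) = (r s).+1].
Proof.
move=> sD tD rst.
(* [rk_augment] only yields a face; applied to a maximal face of rank [r s] between
   [s] and [s :|: t], it raises the rank. *)
pose P u := [&& u \in D, s \subset u, u \subset s :|: t & r u == r s].
have Ps : P s by rewrite /P sD subxx subsetUl eqxx.
have [u /maxsetP[/and4P[uD su ust /eqP ru] umax] _] := maxset_exists Ps.
have [y /setDP[yt yu] yuD] : exists2 y, y \in t :\: u & y |: u \in D.
  by apply: rk_augment => //; rewrite ru.
have ysD : y |: s \in D by apply: faces_closed yuD _; apply: setUS.
exists y; split => //; first by apply: contra yu; apply: (subsetP su).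
have ryu : r u < r (y |: u).
  rewrite ltn_neqAle rk_mono ?subsetUr // andbT; apply/negP => /eqP ruy.
  have Pyu : P (y |: u).
    rewrite /P yuD (subset_trans su) ?subsetUr //= -ruy ru eqxx andbT.
    by rewrite subUset sub1set inE yt orbT.
  by have := umax _ Pyu (subsetUr _ _) => /setP/(_ y); rewrite !inE eqxx (negbTE yu).
have E1 : (y |: s) :|: u = y |: u by rewrite -setUA; congr (_ :|: _); apply/setUidPr.
have E2 : (y |: s) :&: u = s.
  apply/setP => z; rewrite !inE; have [->|_] := eqVneq z y.
    rewrite (negbTE yu) andbF; symmetry; apply/negbTE; apply: contra yu.
    exact: (subsetP su).
  by case: (boolP (z \in s)) => // /(subsetP su) ->.
have := rk_submodular ysD uD; rewrite E1 E2 => /(_ yuD).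
by have := rkU1_le ysD; lia.
Qed.

(** A face of larger rank would augment [B] to a larger independent face. *)
Lemma rk_le_base B t : base C B -> t \in D -> r t <= r B.
Proof.
move=> /maxsetP[/andP[BD /eqP rB] Bmax] tD; rewrite leqNgt; apply/negP => lt.
have [y [_ yB yBD ry]] := augment BD tD lt.
have : independent C (y |: B) by rewrite /independent yBD ry rB cardsU1 yB /=; lia.
move=> /Bmax /(_ (subsetUr _ _)) /setP/(_ y).
by rewrite !inE eqxx (negbTE yB).
Qed.

Lemma independent0 : independent C set0.
Proof. by rewrite /independent set0_faces rk0 cards0. Qed.

Lemma independent_extend I : independent C I -> exists2 B, base C B & I \subset B.
Proof. by move=> /maxset_exists[B]; exists B. Qed.

Lemma base_rank B : base C B -> r B = rank C.
Proof.
move=> bB; apply/eqP; rewrite eqn_leq /rank.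
have rbase B' : base C B' -> r B' = #|B'| by case/maxsetP => /andP[_ /eqP].
rewrite rbase // (leq_bigmax_cond _ bB) /=.
apply/bigmax_leqP => B' bB'; rewrite -!rbase //; apply: rk_le_base => //.
by case/maxsetP: bB' => /andP[].
Qed.

Lemma rk_le_rank s : s \in D -> r s <= rank C.
Proof.
have [B bB _] := independent_extend independent0.
by rewrite -(base_rank bB); apply: rk_le_base.
Qed.

Lemma base_face B : base C B -> B \in D.
Proof. by case/maxsetP => /andP[]. Qed.

Lemma rankE n : (forall s, s \in D -> r s <= n) ->
  (exists2 s, s \in D & r s = n) -> rank C = n.
Proof.
move=> ub [s sD rs]; apply/eqP; rewrite eqn_leq -{2}rs rk_le_rank // andbT.
have [B bB _] := independent_extend independent0.
by rewrite -(base_rank bB); apply/ub/base_face.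
Qed.

End Rank.

(** * Deletion and contraction of semimatroids *)

Section Minors.
Context {S : finType} (C : semimatroid S).
Implicit Types (s t : {set S}).
Local Notation r := (rk C).
Local Notation D := (faces C).

Section Deletion.
Variable x : S.

Lemma deletion_nonvoid : cdeletion D x != set0.
Proof. by apply/set0Pn; exists set0; rewrite inE set0_faces inE. Qed.

Lemma deletion_closed : face_closed (cdeletion D x).
Proof.
move=> s t; rewrite !inE => /andP[tD xt] st; rewrite (faces_closed tD st).
by apply: contra xt; apply: (subsetP st).
Qed.

Lemma deletion_faceP s : s \in cdeletion D x -> s \in D.
Proof. by rewrite inE => /andP[]. Qed.

Lemma deletion_closure s t : s \in cdeletion D x -> t \in cdeletion D x ->
  r s = r (s :&: t) -> s :|: t \in cdeletion D x.
Proof.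
rewrite !inE => /andP[sD xs] /andP[tD xt] rst.
by rewrite (rk_closure sD tD rst) (negbTE xs).
Qed.

Lemma deletion_augment s t : s \in cdeletion D x -> t \in cdeletion D x ->
  r s < r t -> exists2 y, y \in t :\: s & y |: s \in cdeletion D x.
Proof.
rewrite !inE => /andP[sD xs] /andP[tD xt] rst.
have [y yts ysD] := rk_augment sD tD rst; exists y => //.
rewrite !inE ysD (negbTE xs) orbF /=; apply: contra xt => /eqP ->.
by case/setDP: yts.
Qed.

Definition deletion : semimatroid S :=
  Semimatroid deletion_nonvoid deletion_closed
    (fun s sD => rk_le_card (deletion_faceP sD))
    (fun s t sD tD => rk_mono (deletion_faceP sD) (deletion_faceP tD))
    (fun s t sD tD stD => rk_submodular (deletion_faceP sD) (deletion_faceP tD)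
      (deletion_faceP stD))
    deletion_closure deletion_augment.

End Deletion.

Section Contraction.
Variables (x : S) (xD : [set x] \in D).
Local Notation L := (clink D x).
Local Notation rc := (fun s => r (x |: s) - r [set x]).

Lemma contraction_nonvoid : L != set0.
Proof. by apply/set0Pn; exists set0; rewrite !inE /= setU0. Qed.

Lemma contraction_closed : face_closed L.
Proof.
move=> s t; rewrite !inE => /andP[xt tD] st.
rewrite (faces_closed tD) ?setUS // andbT.
by apply: contra xt; apply: (subsetP st).
Qed.

Lemma linkP s : s \in L -> [/\ x \notin s, x |: s \in D & s \in D].
Proof.
by rewrite inE => /andP[xs xsD]; split=> //; apply: faces_closed xsD (subsetUr _ _).
Qed.

(** Ensures that the truncated subtraction in the rank of the contraction is a true one. *)
Lemma rk1_le s : x |: s \in D -> r [set x] <= r (x |: s).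
Proof. by move=> xsD; apply: rk_mono => //; apply: subsetUl. Qed.

Lemma contraction_le_card s : s \in L -> rc s <= #|s|.
Proof.
move=> /linkP[xs xsD sD]; have := rkU_le xsD; have := rk_le_card sD; lia.
Qed.

Lemma contraction_mono s t : s \in L -> t \in L -> s \subset t -> rc s <= rc t.
Proof.
by move=> /linkP[_ sD _] /linkP[_ tD _] st; rewrite leq_sub2r // rk_mono // setUS.
Qed.

Lemma contraction_submodular s t : s \in L -> t \in L -> s :|: t \in L ->
  rc (s :|: t) + rc (s :&: t) <= rc s + rc t.
Proof.
move=> /linkP[_ sD _] /linkP[_ tD _] /linkP[_ stD _].
have stE : (x |: s) :|: (x |: t) = x |: (s :|: t).
  by rewrite setUACA setUid.
have := rk_submodular sD tD; rewrite stE -setUIr => /(_ stD).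
have := rk1_le sD; have := rk1_le tD; have := rk1_le stD.
have := @rk1_le (s :&: t) (faces_closed sD (setUS _ (subsetIl _ _))); lia.
Qed.

Lemma contraction_closure s t : s \in L -> t \in L ->
  rc s = rc (s :&: t) -> s :|: t \in L.
Proof.
move=> /linkP[xs sD _] /linkP[xt tD _] rst.
have stD : x |: (s :&: t) \in D := faces_closed sD (setUS _ (subsetIl _ _)).
have /(rk_closure sD tD) : r (x |: s) = r ((x |: s) :&: (x |: t)).
  by rewrite -setUIr; have := rk1_le sD; have := rk1_le stD; lia.
by rewrite setUACA setUid !inE (negbTE xs) (negbTE xt).
Qed.

Lemma contraction_augment s t : s \in L -> t \in L -> rc s < rc t ->
  exists2 y, y \in t :\: s & y |: s \in L.
Proof.
move=> /linkP[xs sD _] /linkP[xt tD _] rst.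
have /(rk_augment sD tD)[y] : r (x |: s) < r (x |: t).
  by have := rk1_le sD; have := rk1_le tD; lia.
rewrite !inE negb_or => /andP[/andP[yx ys]].
rewrite (negbTE yx) /= => yt yxsD; exists y; first by rewrite !inE ys.
by rewrite !inE eq_sym (negbTE yx) xs setUCA.
Qed.

Definition contraction : semimatroid S :=
  Semimatroid contraction_nonvoid contraction_closed contraction_le_card
    contraction_mono contraction_submodular contraction_closure
    contraction_augment.

End Contraction.

Lemma big_del_link (A : nmodType) (G : {set {set S}}) x (F : {set S} -> A) :
  (\sum_(s in G) F s =
   \sum_(s in cdeletion G x) F s + \sum_(s in clink G x) F (x |: s))%R.
Proof.
rewrite (bigID (fun s => x \notin s)) /=; congr (_ + _)%R.
  by apply: eq_bigl => s; rewrite inE.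
rewrite (reindex_onto (fun s => x |: s) (fun s => s :\ x)) /=; last first.
  by move=> s /andP[_ /negPn xs]; rewrite setD1K.
apply: eq_bigl => s; rewrite !inE eqxx /= andbT andbC.
have [xs|xs] := boolP (x \in s); last by rewrite setU1K // eqxx.
by apply/negbTE/negP => /andP[/eqP E]; move: xs; rewrite -E !inE eqxx.
Qed.

End Minors.

(** * Circuits and broken circuits *)

Section BrokenCircuitComplex.
Context {disp : Order.disp_t} {S : finOrderType disp}.
Implicit Types (C : semimatroid S) (s t c : {set S}).

Lemma dependent_circuit C s : dependent C s -> exists2 c, circuit C c & c \subset s.
Proof. by case/minset_exists => c; exists c. Qed.

Lemma circuit_dep C c : circuit C c -> dependent C c.
Proof. by case/minsetP. Qed.

Lemma independentPn C s : s \in faces C -> ~~ independent C s -> dependent C s.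
Proof.
move=> sD; rewrite /independent /dependent sD /= => ne.
by rewrite ltn_neqAle ne rk_le_card.
Qed.

Lemma circuit_n0 C c : circuit C c -> c != set0.
Proof.
move=> /circuit_dep/andP[_ lt]; rewrite -card_gt0; lia.
Qed.

Lemma min_exists (c : {set S}) : c != set0 ->
  exists2 m, m \in c & forall y, y \in c -> (m <= y)%O.
Proof.
by move=> /set0Pn[z zc]; case: (arg_minP id zc) => m mc mmin; exists m.
Qed.

(** The condition of [BC] in propositional form, with the circuit and its minimum as explicit
    arguments. *)
Definition bc_free C s := forall c m, circuit C c -> m \in c ->
  (forall y, y \in c -> (m <= y)%O) -> ~~ (c :\ m \subset s).

Lemma BCP C s : reflect (s \in faces C /\ bc_free C s) (s \in BC C).
Proof.
rewrite inE; apply: (iffP andP) => -[sD H]; split => //.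
  move=> c m cc mc mmin; have /implyP := forallP H (c :\ m); apply.
  apply/existsP; exists c; rewrite cc; apply/existsP; exists m; rewrite mc eqxx andbT.
  by apply/forall_inP.
apply/forallP => b; apply/implyP => /existsP[c /andP[cc]].
case/existsP => m /andP[mc /andP[/forall_inP mmin /eqP ->]].
exact: H cc mc mmin.
Qed.

Lemma BC_closed C : face_closed (BC C).
Proof.
move=> s t /BCP[tD tf] st; apply/BCP; split; first exact: faces_closed tD st.
move=> c m cc mc mmin; apply: contra (tf c m cc mc mmin) => cs.
exact: subset_trans cs st.
Qed.

Lemma BC_independent C s : s \in BC C -> independent C s.
Proof.
move=> /BCP[sD sf]; apply/negPn/negP => /(independentPn sD).
move=> /dependent_circuit[c cc cs].
have [m mc mmin] := min_exists (circuit_n0 cc).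
by have /negP[] := sf c m cc mc mmin; rewrite (subset_trans _ cs) ?subsetDl.
Qed.

Lemma BC_face C s : s \in BC C -> s \in faces C.
Proof. by case/BCP. Qed.

(** A loop is a one-element circuit; its broken circuit is empty and lies in every face. *)
Lemma BC_loop C x : [set x] \in faces C -> rk C [set x] = 0 -> BC C = set0.
Proof.
move=> xD rx; apply/setP => s; rewrite in_set0;
  apply/negbTE/negP => /BCP[sD /(_ [set x] x)].
rewrite setDv sub0set /= => H; apply/negP/H: isT; rewrite ?inE //; last first.
  by move=> y /set1P ->.
apply/minsetP; split=> [|c]; first by rewrite /dependent xD rx cards1.
move=> dc /[!subset1] /orP[/eqP // | /eqP c0]; move: dc.
by rewrite c0 /dependent cards0 ltn0 andbF.
Qed.

(** By minimality [c :\ m] is independent, so its rank [#|c| - 1] already reaches the largest value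
    possible for a dependent [c]. *)
Lemma circuit_rkD1 C c m : circuit C c -> m \in c -> rk C (c :\ m) = rk C c.
Proof.
move=> /minsetP[/andP[cD rc] cmin] mc.
have cmD : c :\ m \in faces C by apply: faces_closed cD (subsetDl _ _).
apply/eqP; rewrite eqn_leq rk_mono ?subsetDl //=.
have: independent C (c :\ m).
  apply/negPn/negP => /(independentPn cmD) dcm.
  by have := cmin _ dcm (subsetDl _ _) => /setP/(_ m); rewrite !inE mc eqxx.
by case/andP => _ /eqP ->; have := cardsD1 m c; rewrite mc; lia.
Qed.

(** * Broken circuits under deletion and contraction of the largest vertex *)

Section MaxVertex.
Variables (C : semimatroid S) (x : S).
Hypotheses (xD : [set x] \in faces C) (rx : rk C [set x] = 1).
Hypothesis xmax : forall y, [set y] \in faces C -> (y <= x)%O.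

Let mem_le_max s y : s \in faces C -> y \in s -> (y <= x)%O.
Proof. by move=> sD ys; apply/xmax/(faces_closed sD); rewrite sub1set. Qed.

Lemma circuit_deletion c : circuit (deletion C x) c = circuit C c && (x \notin c).
Proof.
have depE d : dependent (deletion C x) d = dependent C d && (x \notin d).
  by rewrite /dependent inE andbAC.
apply/minsetP/andP => [[]|[/minsetP[dc cmin] xc]].
  rewrite depE => /andP[dc xc] cmin; split=> //; apply/minsetP; split=> // d dd dc'.
  by apply: cmin; rewrite // depE dd /=; apply: contra xc; apply: (subsetP dc').
by split=> [|d]; rewrite depE ?dc // => /andP[dd _]; apply: cmin.
Qed.

(** If the largest vertex were the minimum of the circuit, the circuit would be [[set x]], which is
    independent. *)
Let circuit_min_ne c m : circuit C c -> m \in c -> x \in c ->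
  (forall y, y \in c -> (m <= y)%O) -> m != x.
Proof.
move=> cc mc xc mmin; apply/negP => /eqP mx.
have cx : c = [set x].
  apply/eqP; rewrite eqEsubset sub1set xc andbT; apply/subsetP => y yc.
  have /andP[cD _] := circuit_dep cc.
  by rewrite inE eq_le (mem_le_max cD yc) -mx mmin.
by move/circuit_dep: cc; rewrite cx /dependent rx cards1 ltnn andbF.
Qed.

(** A circuit through [x] keeps [x] in its broken circuit, so it puts no condition on faces that
    avoid [x]. *)
Lemma BC_deletion : BC (deletion C x) = cdeletion (BC C) x.
Proof.
apply/setP => s; rewrite [RHS]inE; apply/BCP/andP.
  rewrite inE => -[/andP[sD xs] sf]; split=> //; apply/BCP; split=> // c m cc mc mmin.
  have [xc|xc] := boolP (x \in c); last by apply: sf; rewrite // circuit_deletion cc.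
  apply: contra xs => /subsetP; apply.
  by rewrite !inE xc eq_sym (circuit_min_ne cc mc xc mmin).
move=> [/BCP[sD sf] xs]; split; first by rewrite inE sD.
by move=> c m; rewrite circuit_deletion => /andP[cc _]; apply: sf.
Qed.

Let contraction_dep c : dependent (contraction xD) c =
  (x \notin c) && dependent C (x |: c).
Proof.
rewrite /dependent [c \in _]inE; case: (boolP (x \notin c)) => //= xc.
case: (boolP (x |: c \in faces C)) => //= xcD.
rewrite cardsU1 xc rx; have := rk1_le xD xcD; rewrite rx /=; lia.
Qed.

(** A broken circuit of [C] inside [x |: s] yields one of the contraction inside [s], and
    conversely; [x], being largest, never interferes with the minimum. *)
Lemma BC_contraction : BC (contraction xD) = clink (BC C) x.
Proof.
apply/setP => s; rewrite [RHS]inE; apply/BCP/andP.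
  move=> [/linkP[xs xsD sD] sf]; split=> //; apply/BCP; split=> // c m cc mc mmin.
  apply/negP => cms; have /andP[cD rc] := circuit_dep cc.
  (* A circuit through [x] gives the circuit [c :\ x] of the contraction, with the same minimum. *)
  have [xc|xc] := boolP (x \in c).
    have mx := circuit_min_ne cc mc xc mmin.
    have /negP[] : ~~ ((c :\ x) :\ m \subset s).
      apply: sf; last by move=> y /setD1P[_]; apply: mmin.
        apply/minsetP; split.
          by rewrite contraction_dep !inE eqxx setD1K ?circuit_dep.
        move=> d; rewrite contraction_dep => /andP[xd dd] dc.
        case/minsetP: cc => _ /(_ _ dd) <-; last by rewrite -(setD1K xc) setUS.
        by rewrite setU1K.
      by rewrite !inE mx.
    apply/subsetP => y; rewrite !inE => /andP[ym /andP[yx yc]].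
    by have /(subsetP cms) : y \in c :\ m; rewrite !inE ?ym ?yc // (negbTE yx).
  have cmsD : x |: (c :\ m) \in faces C.
    by apply: faces_closed xsD _; rewrite subUset subsetUl.
  have cmxE : c :&: (x |: (c :\ m)) = c :\ m.
    apply/setP => y; rewrite !inE; have [->|] := eqVneq y x;
      first by rewrite (negbTE xc) !andbF.
    by case: (y \in c); rewrite ?andbF ?andbT.
  (* [c :\ m] has the rank of [c] and is the intersection of [c] with a face containing [x], so
     [rk_closure] makes [x |: c] a face. *)
  have xcD : x |: c \in faces C.
    have := rk_closure cD cmsD; rewrite cmxE circuit_rkD1 // => /(_ erefl).
    by rewrite setUCA (setUidPl (subsetDl c [set m])).
  have : dependent (contraction xD) c.
    rewrite contraction_dep xc /dependent xcD cardsU1 xc /=.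
    by apply: leq_ltn_trans (rkU1_le xcD) _; rewrite add1n ltnS.
  move=> /dependent_circuit[d dd dc].
  have [n nd nmin] := min_exists (circuit_n0 dd).
  have /negP[] := sf d n dd nd nmin.
  apply/subsetP => y /setD1P[yn yd]; have yc := subsetP dc _ yd.
  have yx : y != x by apply: contra xc => /eqP <-.
  (* If [m] lies in [d], it is also the minimum [n] of [d], which was removed. *)
  have ym : y != m.
    apply: contra yn => /eqP ym; rewrite eq_le nmin // ym mmin //.
    exact: (subsetP dc).
  by have /(subsetP cms) : y \in c :\ m; rewrite !inE ?ym ?yc // (negbTE yx).
(* Conversely, [x |: d] is dependent, and a circuit in it has its broken circuit inside [x |: s]. *)
move=> [xs /BCP[xsD sf]]; split; first by rewrite inE xs.
move=> d n dd nd nmin; apply/negP => dns.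
have := circuit_dep dd; rewrite contraction_dep => /andP[xd dxd].
have [c cc cxd] := dependent_circuit dxd.
have [m mc mmin] := min_exists (circuit_n0 cc).
have /andP[xdD _] := dxd.
have /negP[] := sf c m cc mc mmin.
apply/subsetP => y /setD1P[ym yc]; have := subsetP cxd _ yc; rewrite !inE.
case: eqVneq => //= yx yd.
apply: (subsetP dns); rewrite !inE yd andbT; apply: contra ym => /eqP yn.
rewrite eq_le mmin // andbT yn.
have := subsetP cxd _ mc; rewrite !inE => /orP[/eqP->|/nmin //].
by apply: mem_le_max xdD _; rewrite !inE nd orbT.
Qed.

End MaxVertex.

Lemma max_vertexP C : (exists x, [set x] \in faces C) ->
  exists2 x, [set x] \in faces C & forall y, [set y] \in faces C -> (y <= x)%O.
Proof. by move=> [y yD]; case: (arg_maxP (P := fun y => [set y] \in faces C) id yD) =>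
  x; exists x. Qed.

Lemma faces_deletion_lt C x : [set x] \in faces C ->
  #|faces (deletion C x)| < #|faces C|.
Proof.
move=> xD; apply: proper_card; rewrite properE; apply/andP; split.
  by apply/subsetP => s; rewrite inE => /andP[].
by apply/subsetPn; exists [set x] => //; rewrite !inE eqxx andbF.
Qed.

Lemma faces_contraction_lt C x (xD : [set x] \in faces C) :
  #|faces (contraction xD)| < #|faces C|.
Proof.
apply: proper_card; rewrite properE; apply/andP; split.
  by apply/subsetP => s /linkP[].
by apply/subsetPn; exists [set x] => //; rewrite !inE eqxx.
Qed.

Lemma no_vertex_faces C : ~ (exists x, [set x] \in faces C) -> faces C = [set set0].
Proof.
move=> noD; apply/setP => s; rewrite inE; apply/idP/eqP => [sD|->];
  last exact: set0_faces.
apply/eqP/negPn/negP => /set0Pn[x xs]; apply: noD; exists x.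
by apply: faces_closed sD _; rewrite sub1set.
Qed.

Lemma no_vertex_BC C : faces C = [set set0] -> BC C = [set set0].
Proof.
move=> CE; apply/setP => s; apply/idP/idP => [/BC_face|]; first by rewrite CE.
move=> s0; apply/BCP; split=> [|c m cc]; first by rewrite CE.
have := circuit_n0 cc; have /andP[] := circuit_dep cc.
by rewrite CE inE => /eqP ->; rewrite eqxx.
Qed.

(** * The face polynomial and the Tutte polynomial *)

Local Open Scope ring_scope.

(** Both sides split over the deletion and the link of the largest vertex [x]. If [x] is a loop, the
    left sum is empty, and on the right the terms of [s] and [x |: s] cancel. *)
Lemma fpoly_BC (A : comNzRingType) (q : A) C :
  fpoly (BC C) q = \sum_(s in faces C) q ^+ rk C s * (-1) ^+ (#|s| - rk C s).
Proof.
have [n] := ubnP #|faces C|; elim: n C => // n IH C; rewrite ltnS => Cn.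
case: (altP (@existsP _ (fun x => [set x] \in faces C))) =>
  [/max_vertexP[x xD xmax]|/existsP noD].
  rewrite [RHS](big_del_link _ x) /=.
  case: (posnP (rk C [set x])) => [rx|rx_gt0].
    rewrite /fpoly (BC_loop xD) // big_set0; apply/esym/eqP; rewrite addr_eq0 -sumrN;
      apply/eqP.
    (* By [rk_closure] a loop can be added to every face. *)
    have delE : cdeletion (faces C) x = clink (faces C) x.
      apply/setP => s; rewrite !inE andbC; case: (boolP (x \in s)) => //= xs.
      apply/idP/idP => [sD|xsD]; last exact: faces_closed xsD (subsetUr _ _).
      apply: rk_closure => //; rewrite rx.
      by rewrite (_ : _ :&: _ = set0) ?rk0 //; apply/setP => y; rewrite !inE;
        case: eqVneq => [->|]; rewrite ?(negbTE xs).
    rewrite -delE; apply: eq_big => // s; rewrite delE => /linkP[xs xsD sD].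
    have rxs : rk C (x |: s) = rk C s.
      apply/eqP; rewrite eqn_leq (rk_mono sD xsD) ?subsetUr // andbT.
      by have := rkU_le xsD; rewrite rx.
    by rewrite rxs cardsU1 xs /= add1n subSn ?rk_le_card // exprS mulN1r mulrN opprK.
  have rx : rk C [set x] = 1%N by have := rk_le_card xD; rewrite cards1; lia.
  rewrite /fpoly (big_del_link _ x) -(BC_deletion rx) // -(BC_contraction xD) //;
    congr (_ + _).
    by apply: (IH (deletion C x)); apply: leq_trans (faces_deletion_lt xD) Cn.
  rewrite (eq_bigr (fun s : {set S} => q * q ^+ #|s|)); last first.
    by move=> s; rewrite (BC_contraction xD) // inE => /andP[xs _];
      rewrite cardsU1 xs exprS.
  rewrite -big_distrr /= [X in _ * X](IH (contraction xD)); last first.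
    exact: leq_trans (faces_contraction_lt xD) Cn.
  rewrite big_distrr /=; apply: eq_bigr => s /linkP[xs xsD sD].
  have := rk1_le xD xsD; rewrite /= rx cardsU1 xs add1n => rxs.
  rewrite mulrA -exprS; congr (_ ^+ _ * _ ^+ _); first by rewrite subn1 prednK.
  by rewrite subnBA // addn1.
have DE := no_vertex_faces noD.
by rewrite /fpoly DE no_vertex_BC // !big_set1 rk0 cards0 mulr1.
Qed.

(** Holds term by term, since [(q + 1) / q - 1] is the inverse of [q]. *)
Lemma fpoly_BC_tutte (F : fieldType) (q : F) C : q != 0 ->
  fpoly (BC C) q = q ^+ rank C * tutte C ((q + 1) / q) 0.
Proof.
move=> q0; rewrite fpoly_BC /tutte big_distrr /=; apply: eq_bigr => s sD.
rewrite mulrA sub0r; congr (_ * _).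
have -> : (q + 1) / q - 1 = q^-1 by rewrite mulrDl divff // mul1r addrAC subrr add0r.
have {1}-> : rank C = (rank C - rk C s + rk C s)%N by rewrite subnK // rk_le_rank.
by rewrite exprD mulrAC exprVn divff ?mul1r // expf_neq0.
Qed.

(** The formula at [q = -1], proved separately because it is applied over the integers, which are
    not a field. *)
Lemma fpoly_BC_N1 (A : comNzRingType) C :
  fpoly (BC C) (-1 : A) = (-1) ^+ rank C * tutte C 0 0.
Proof.
rewrite fpoly_BC /tutte big_distrr /=; apply: eq_bigr => s sD.
rewrite mulrA !sub0r; congr (_ * _).
have {1}-> : rank C = (rank C - rk C s + rk C s)%N by rewrite subnK // rk_le_rank.
by rewrite exprD mulrAC -exprMn mulrNN mulr1 expr1n mul1r.
Qed.

Local Close Scope ring_scope.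

(** * Ranks of minors and isthmuses *)

Lemma rank_contraction C x (xD : [set x] \in faces C) : rk C [set x] = 1 ->
  rank C = (rank (contraction xD)).+1.
Proof.
move=> rx; have [|B bB xB] := @independent_extend _ C [set x].
  by rewrite /independent xD rx cards1.
have rB := base_rank bB; have BD := base_face bB.
have xBE : x |: B :\ x = B by rewrite setD1K // -sub1set.
have := rk_mono xD BD xB; rewrite rx rB => rk_gt0.
rewrite -[LHS]prednK //; congr _.+1; apply/esym/rankE => [s /linkP[_ xsD _]|].
  by rewrite /= rx subn1 -!subn1 leq_sub2r // rk_le_rank.
exists (B :\ x); first by rewrite !inE eqxx xBE.
by rewrite /= xBE rB rx subn1.
Qed.

Lemma rank_deletion_le C x : rank (deletion C x) <= rank C <= (rank (deletion C x)).+1.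
Proof.
apply/andP; split.
  have [B bB _] := independent_extend (independent0 (deletion C x)).
  rewrite -(base_rank bB); apply: (@rk_le_rank _ C).
  exact: deletion_faceP (base_face bB).
have [B bB _] := independent_extend (independent0 C).
rewrite -(base_rank bB); have BD := base_face bB.
have BxD : B :\ x \in faces (deletion C x).
  by rewrite !inE eqxx (faces_closed BD) ?subsetDl.
have [xB|xB] := boolP (x \in B).
  rewrite -{1}(setD1K xB); apply: leq_trans (rkU1_le _) _; first by rewrite setD1K.
  by rewrite ltnS; exact: (@rk_le_rank _ (deletion C x)).
apply/leqW/(@rk_le_rank _ (deletion C x)); first by rewrite inE BD.
Qed.

(** Extend [s] to a maximal face [t] avoiding [x]. Its rank is below that of a base, so it can be
    augmented, and only by [x]; submodularity carries the jump in rank down to [s]. *)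
Lemma isthmus_face C x s : rank (deletion C x) < rank C ->
  s \in faces C -> x \notin s ->
  x |: s \in faces C /\ rk C (x |: s) = (rk C s).+1.
Proof.
move=> rlt sD xs.
have [t /maxsetP[tL tmax] st] : {t | maxset (fun u =>
  u \in faces (deletion C x)) t & s \subset t}.
  by apply: maxset_exists; rewrite inE sD.
have := tL; rewrite inE => /andP[tD xt].
have [B bB _] := independent_extend (independent0 C).
have rtB : rk C t < rk C B.
  by rewrite (base_rank bB); apply: leq_ltn_trans rlt;
    exact: (@rk_le_rank _ (deletion C x)).
have [y [yB yt ytD ryt]] := augment tD (base_face bB) rtB.
have yx : y = x.
  apply/eqP/negPn/negP => yx; have /tmax : y |: t \in faces (deletion C x).
    by rewrite !inE ytD (negbTE xt) eq_sym (negbTE yx).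
  by move=> /(_ (subsetUr _ _)) /setP/(_ y); rewrite !inE eqxx (negbTE yt).
rewrite yx in yB yt ytD ryt.
have xsD : x |: s \in faces C by apply: faces_closed ytD (setUS _ st).
split=> //; apply/eqP; rewrite eqn_leq rkU1_le //=.
have E1 : (x |: s) :|: t = x |: t by rewrite -setUA (setUidPr st).
have E2 : (x |: s) :&: t = s.
  by rewrite setIUl (setIidPl st); apply/setUidPr/subsetP => z;
    rewrite !inE => /andP[/eqP->]; rewrite (negbTE xt).
by have := rk_submodular xsD tD; rewrite E1 E2 ryt => /(_ ytD); lia.
Qed.

(** An isthmus lies in no circuit, because removing an element of a circuit keeps the rank. Hence a
    broken circuit inside [x |: s] already lies in [s]. *)
Lemma isthmus_BC C x s : rank (deletion C x) < rank C ->
  s \in BC C -> x |: s \in BC C.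
Proof.
move=> rlt sB; have [xs|xs] := boolP (x \in s).
  by rewrite (_ : x |: s = s) //; apply/setUidPr; rewrite sub1set.
have /BCP[sD sf] := sB; have [xsD _] := isthmus_face rlt sD xs.
apply/BCP; split=> // c m cc mc mmin; apply: contra (sf c m cc mc mmin).
have xc : x \notin c.
  apply/negP => xc; have /andP[cD _] := circuit_dep cc.
  have cxD : c :\ x \in faces C by apply: faces_closed cD (subsetDl _ _).
  have [|_] := isthmus_face rlt cxD; first by rewrite !inE eqxx.
  by rewrite setD1K // (circuit_rkD1 cc xc) => /esym; lia.
move=> /subsetP cms; apply/subsetP => y ycm; have := cms y ycm.
rewrite !inE => /orP[/eqP yx|//].
by move: ycm xc; rewrite yx !inE => /andP[_ ->].
Qed.

End BrokenCircuitComplex.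

(** * Vertex-decomposability of cones *)

Section VertexDecomposable.
Context {S : finType}.
Implicit Types (G L : {set {set S}}) (s t : {set S}) (x y : S).

Lemma csizeE G n : (forall s, s \in G -> #|s| <= n) ->
  (exists2 s, s \in G & #|s| = n) -> csize G = n.
Proof.
move=> ub [s sG sn]; apply/eqP; rewrite eqn_leq -{2}sn.
rewrite [_ <= csize G]leq_bigmax_cond // andbT; exact/bigmax_leqP.
Qed.

Lemma csize_attained G : G != set0 -> exists2 s, s \in G & #|s| = csize G.
Proof.
move=> /set0Pn[s0 s0G].
have [|s sG E] := @eq_bigmax_cond _ (fun s => s \in G) (fun s => #|s|).
  by apply/card_gt0P; exists s0.
by exists s.
Qed.

Lemma card_csize G s : s \in G -> #|s| <= csize G.
Proof. by move=> sG; apply: leq_bigmax_cond. Qed.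

Lemma pureE G n : (forall s, s \in G -> #|s| <= n) ->
  (forall s, s \in G -> exists t, [/\ t \in G, s \subset t & #|t| = n]) -> pure G.
Proof.
move=> ub ext s /maxsetP[sG smax]; have [t [tG st tn]] := ext s sG.
rewrite -(smax t tG st) tn; apply/esym/csizeE => //; by exists t.
Qed.

(** The cone over [L] with apex [x]; testing [s :\ x] covers the faces with and without the apex at
    once. *)
Definition is_cone G L x :=
  (forall s, (s \in G) = (s :\ x \in L)) /\ (forall s, s \in L -> x \notin s).

Lemma cone_csize G L x : is_cone G L x -> L != set0 -> csize G = (csize L).+1.
Proof.
move=> [GE Lx] Ln0; apply: csizeE => [s|].
  rewrite GE => /card_csize; have := cardsD1 x s; case: (x \in s) => /=; lia.
have [s sL sn] := csize_attained Ln0; exists (x |: s).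
  by rewrite GE setU1K ?Lx.
by rewrite cardsU1 Lx // sn.
Qed.

(** Serves for isthmuses, which cannot be shed because their deletion has smaller dimension. A
    shedding vertex of the base also sheds the cone, since its deletion and link in the cone are
    cones over those in the base. *)
Lemma vd_cone G L x : is_cone G L x -> vertex_decomposable L -> vertex_decomposable G.
Proof.
move=> + vdL; elim: vdL G => [|A|{}L y Lcl Lpure yL szd vd IHd szl vl IHl] G cone.
- rewrite (_ : G = set0); first exact: vd_void.
  by apply/setP => s; rewrite cone.1 !inE.
- rewrite (_ : G = powerset (x |: A)); first exact: vd_simplex.
  by apply/setP => s; rewrite cone.1 !inE subDset.
have [GE Lx] := cone.
have yx : y != x by have := Lx _ yL; rewrite inE eq_sym.
have L0 : set0 \in L by apply: Lcl yL (sub0set _).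
have cone_d : is_cone (cdeletion G y) (cdeletion L y) x.
  split=> [s|s]; last by rewrite inE => /andP[/Lx].
  by rewrite !inE GE yx.
have cone_l : is_cone (clink G y) (clink L y) x.
  split=> [s|s]; last by rewrite inE => /andP[_ /Lx]; rewrite !inE negb_or => /andP[].
  rewrite !inE GE yx /=; congr (_ && (_ \in L)).
  apply/setP => z; rewrite !inE; case: (eqVneq z x) => [->|//];
    by rewrite eq_sym (negbTE yx).
have szG : csize G = (csize L).+1 by apply: cone_csize cone _; apply/set0Pn; exists set0.
apply: (@vd_shed _ G y).
- by move=> s t; rewrite !GE => tG st; apply: Lcl tG _; apply: setSD.
- apply: (@pureE _ (csize G)) => [s|s]; first exact: card_csize.
  rewrite GE => sL; have [t /maxsetP[tL tmax] st] := maxset_exists (P := fun u =>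
    u \in L) sL.
  have tfac : facet L t by apply/maxsetP.
  exists (x |: t); split; first by rewrite GE setU1K ?Lx.
    by rewrite -subDset.
  by rewrite cardsU1 Lx // (Lpure _ tfac) szG.
- by rewrite GE (_ : _ :\ x = [set y]) //; apply/setP => z;
  rewrite !inE andb_idl // => /eqP->.
- rewrite szG -szd; apply: cone_csize cone_d _.
  by apply/set0Pn; exists set0; rewrite !inE L0.
- exact: IHd.
- rewrite szG -szl; congr _.+1; apply: cone_csize cone_l _.
  by apply/set0Pn; exists set0; rewrite !inE setU0 yL.
- exact: IHl.
Qed.

End VertexDecomposable.

(** * Vertex-decomposability of the broken circuit complex *)

Section BCVertexDecomposable.
Context {disp : Order.disp_t} {S : finOrderType disp}.
Implicit Types C : semimatroid S.

Lemma BC_card_le C s : s \in BC C -> #|s| <= rank C.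
Proof.
by move=> /BC_independent/andP[sD /eqP <-]; apply: rk_le_rank.
Qed.

(** The second part supplies the purity and the sizes asked for by [vd_shed], so it is carried
    through the induction. *)
Lemma vd_BC_extend C : vertex_decomposable (BC C) /\
  (forall s, s \in BC C -> exists t, [/\ t \in BC C, s \subset t & #|t| = rank C]).
Proof.
have [n] := ubnP #|faces C|; elim: n C => // n IH C; rewrite ltnS => Cn.
case: (altP (@existsP _ (fun x => [set x] \in faces C))) =>
  [/max_vertexP[x xD xmax]|/existsP noD]; last first.
  have DE := no_vertex_faces noD; rewrite (no_vertex_BC DE); split.
    by rewrite -powerset0; apply: vd_simplex.
  move=> s /set1P ->; exists set0; rewrite inE eqxx sub0set cards0; split=> //.
  apply/esym/rankE => [t|]; first by rewrite DE => /set1P ->; rewrite rk0.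
  by exists set0; rewrite ?rk0 ?set0_faces.
case: (posnP (rk C [set x])) => [/(BC_loop xD) ->|rx_gt0].
  by split=> [|s]; [exact: vd_void | rewrite in_set0].
have rx : rk C [set x] = 1 by have := rk_le_card xD; rewrite cards1; lia.
have [vd_del ext_del] := IH (deletion C x) (leq_trans (faces_deletion_lt xD) Cn).
have [vd_con ext_con] := IH (contraction xD) (leq_trans (faces_contraction_lt xD) Cn).
rewrite (BC_deletion rx xmax) in vd_del ext_del.
rewrite (BC_contraction xD rx xmax) in vd_con ext_con.
have rcon := rank_contraction xD rx.
have BCcl := @BC_closed _ _ C.
have /andP[rdel_le rdel_ge] := rank_deletion_le C x.
have mem_del s : s \in BC C -> s :\ x \in cdeletion (BC C) x.
  by move=> sB; rewrite in_cdeletion !in_setD1 eqxx (BCcl _ _ sB) ?subsetDl.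
(* If [x] is an isthmus, the complex is a cone with apex [x] over that of the deletion. *)
case: (ltnP (rank (deletion C x)) (rank C)) => [isth|nisth].
  split.
    apply: (@vd_cone _ _ _ x _ vd_del); split=> s;
      last by rewrite in_cdeletion => /andP[].
    apply/idP/idP => [/mem_del //|]; rewrite in_cdeletion => /andP[sB _].
    apply: (BCcl _ _ (isthmus_BC isth sB)).
    by rewrite -subDset.
  move=> s /mem_del/ext_del[t [tL st tn]]; exists (x |: t).
  have /setIdP[tB xt] := tL.
  rewrite isthmus_BC // -subDset st cardsU1 xt tn; split=> //; lia.
have rdel : rank (deletion C x) = rank C by apply/eqP; rewrite eqn_leq rdel_le.
rewrite rdel in ext_del.
(* A vertex [x] that is not a loop may still be missing from the complex, for instance when
   [[set x]] is a broken circuit; the complex is then that of the deletion. *)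
have [xB|xB] := boolP ([set x] \in BC C); last first.
  have delE : cdeletion (BC C) x = BC C.
    apply/setP => s; rewrite in_cdeletion; apply: andb_idr => sB; apply: contra xB => xs.
    by apply: BCcl sB _; rewrite sub1set.
  by rewrite delE in vd_del ext_del.
have BC0 : set0 \in BC C by apply: BCcl xB (sub0set _).
have ext s : s \in BC C -> exists t, [/\ t \in BC C, s \subset t & #|t| = rank C].
  move=> sB; have [xs|xs] := boolP (x \in s).
    have [|t [tL st tn]] := ext_con (s :\ x).
      by rewrite in_clink in_setD1 eqxx setD1K.
    move: tL; rewrite in_clink => /andP[xt xtB]; exists (x |: t).
    by rewrite -subDset st cardsU1 xt tn rcon.
  have [|t [tL st tn]] := ext_del s; first by rewrite in_cdeletion sB.
  by exists t; move: tL; rewrite in_cdeletion => /andP[].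
have szG : csize (BC C) = rank C.
  apply: csizeE => [s|]; first exact: BC_card_le.
  by have [t [tB _ tn]] := ext _ BC0; exists t.
split=> //; apply: (@vd_shed _ _ x) => //.
- by apply: pureE ext => s; apply: BC_card_le.
- rewrite szG; apply: csizeE => [s|]; first by rewrite in_cdeletion => /andP[/BC_card_le].
  have [|t [tB _ tn]] := ext_del set0; first by rewrite in_cdeletion BC0 in_set0.
  by exists t.
- rewrite szG rcon; congr _.+1; apply: csizeE => [s|].
    rewrite in_clink => /andP[xs /BC_card_le]; rewrite cardsU1 xs rcon; lia.
  have [|t [tB _ tn]] := ext_con set0; first by rewrite in_clink in_set0 setU0.
  by exists t.
Qed.

Lemma vd_BC C : vertex_decomposable (BC C).
Proof. by have [] := vd_BC_extend C. Qed.

Lemma csize_BC C : BC C != set0 -> csize (BC C) = rank C.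
Proof.
move=> /set0Pn[s0 /(vd_BC_extend C).2[t [tB _ tn]]].
by apply: csizeE => [s|]; [exact: BC_card_le | exists t].
Qed.

End BCVertexDecomposable.

(** * Collapses and critical faces *)

Section Collapsible.
Context {S : finType}.
Implicit Types (G L : {set {set S}}) (a s t : {set S}) (v x : S).

(* The free pairs may start at the empty face, so a nonvoid collapsible complex
   ends with the removal of the pair formed by the empty face and a vertex;
   counting the empty face makes the void complex the base case. *)
Inductive collapsible : {set {set S}} -> Prop :=
| coll_void : collapsible set0
| coll_step G a v of v \notin a & a \in G & v |: a \in G
    & (forall s, s \in G -> a \subset s -> s = a \/ s = v |: a)
    & collapsible (G :\: [set a; v |: a]) : collapsible G.

(** A free pair [a], [v |: a] of the link gives the free pair [x |: a], [v |: (x |: a)] of [G].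
    Removing these pairs in order leaves the deletion. *)
Lemma collapsible_del_link G x :
  collapsible (clink G x) -> collapsible (cdeletion G x) -> collapsible G.
Proof.
move E: (clink G x) => L cL; elim: cL G E => [|{}L a v va aL vaL free _ IH] G E cD.
  rewrite (_ : G = cdeletion G x) //; apply/setP => s; rewrite in_cdeletion.
  symmetry; apply: andb_idr => sG; apply/negP => xs.
  have : s :\ x \in clink G x by rewrite in_clink !inE eqxx setD1K.
  by rewrite E inE.
have := aL; rewrite -E in_clink => /andP[xa xaG].
have := vaL; rewrite -E in_clink !inE negb_or => /andP[/andP[xv _] xvaG].
apply: (@coll_step _ (x |: a) v).
- by rewrite !inE eq_sym (negbTE xv).
- by [].
- by rewrite setUCA.
- move=> s sG; rewrite subUset sub1set => /andP[xs as_].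
  have sE := setD1K xs.
  have sxL : s :\ x \in L by rewrite -E in_clink !inE eqxx sE.
  have asx : a \subset s :\ x by rewrite subsetD1 as_ xa.
  by case: (free _ sxL asx) => sxE; [left|right]; rewrite -sE sxE // setUCA.
apply: IH.
  rewrite -E; apply/setP => s; rewrite in_clink !in_setD in_clink !in_set2.
  have [xs|xs] := boolP (x \in s); first by rewrite andbF.
  have eqU t : x \notin t -> (x |: s == x |: t) = (s == t).
    by move=> xt; apply/eqP/eqP => [H|->//]; rewrite -(setU1K xs) H setU1K.
  by rewrite setUCA !eqU // !inE negb_or xv.
rewrite (_ : cdeletion _ x = cdeletion G x) //; apply/setP => s.
rewrite !in_cdeletion in_setD in_set2.
have [xs|xs] := boolP (x \in s); first by rewrite !andbF.
rewrite !andbT (_ : (_ || _) = false) //; apply/negP.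
by move=> /orP[]/eqP sE; move: xs; rewrite sE !inE eqxx ?orbT.
Qed.

Lemma collapsible_simplex (A : {set S}) : A != set0 -> collapsible (powerset A).
Proof.
move: {2}#|A| (leqnn #|A|) => n; elim: n A => [|n IH] A.
  by rewrite leqn0 cards_eq0 => ->.
move=> An /set0Pn[x xA].
(* A single vertex is treated apart: its deletion is the empty complex, which is not collapsible in
   this sense. *)
have [A0|A0] := eqVneq (A :\ x) set0.
  have AE : A = [set x] by rewrite -(setD1K xA) A0 setU0.
  have PE s : s \in powerset A = (s == set0) || (s == [set x]).
    by rewrite AE inE subset1 orbC.
  apply: (@coll_step _ set0 x); rewrite ?inE ?sub0set ?setU0 ?AE //.
    by move=> s; rewrite -AE PE => /orP[]/eqP->; [left|right].
  rewrite (_ : _ :\: _ = set0); first exact: coll_void.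
  by apply/setP => s; rewrite -AE in_setD PE in_set2 AE in_set0 andNb.
have cA : collapsible (powerset (A :\ x)).
  by apply: IH => //; have := cardsD1 x A; rewrite xA; lia.
apply: (@collapsible_del_link _ x).
  rewrite (_ : clink _ x = powerset (A :\ x)) //; apply/setP => s.
  by rewrite in_clink !inE subUset sub1set xA subsetD1 andbC.
rewrite (_ : cdeletion _ x = powerset (A :\ x)) //; apply/setP => s.
by rewrite in_cdeletion !inE subsetD1.
Qed.

Lemma vd_collapsible G : vertex_decomposable G ->
  exists Cr : {set {set S}}, [/\ Cr \subset G,
    forall s, s \in Cr -> #|s| = csize G & collapsible (G :\: Cr)].
Proof.
elim=> [|A|{}G x Gcl _ xG szd _ [Cd [CdG Cds cd]] szl _ [Cl [ClG Cls cl]]].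
- by exists set0; split=> [|s|]; rewrite ?sub0set ?setD0 ?inE //; apply: coll_void.
(* The empty complex consists of one critical face; every other simplex collapses without any. *)
- have [->|A0] := eqVneq A set0.
    exists [set set0]; rewrite powerset0 setDv; split=> // [s /set1P->|];
      last exact: coll_void.
    by rewrite /csize big_set1.
  exists set0; split=> [|s|]; rewrite ?sub0set ?inE //.
  by rewrite setD0; apply: collapsible_simplex.
(* The equalities of [csize] in [vd_shed] give all these faces the maximal size. *)
exists [set s : {set S} | if x \in s then s :\ x \in Cl else s \in Cd]; split.
- apply/subsetP => s; rewrite inE; case: ifP => xs.
    by move=> /(subsetP ClG); rewrite in_clink setD1K // => /andP[].
  by move=> /(subsetP CdG); rewrite in_cdeletion => /andP[].
- move=> s; rewrite inE; case: ifP => xs; last by move=> /Cds; rewrite szd.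
  by move=> /Cls sz; rewrite -szl -sz (cardsD1 x s) xs.
apply: (@collapsible_del_link _ x).
  rewrite (_ : clink _ x = clink G x :\: Cl) //; apply/setP => s.
  rewrite in_clink !in_setD in_clink inE setU11.
  by case: (boolP (x \in s)) => [|xs]; rewrite ?andbF // setU1K.
rewrite (_ : cdeletion _ x = cdeletion G x :\: Cd) //; apply/setP => s.
rewrite in_cdeletion !in_setD in_cdeletion inE.
by case: (x \in s); rewrite ?andbF ?andbT.
Qed.

Local Open Scope ring_scope.

(** The two faces of a removed pair contribute opposite signs. *)
Lemma collapsible_euler (A : comNzRingType) G : collapsible G -> fpoly G (-1 : A) = 0.
Proof.
elim=> [|{}G a v va aG vaG _ _ IH]; first by rewrite /fpoly big_set0.
have ne : v |: a != a by apply: contra va => /eqP <-; rewrite setU11.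
rewrite /fpoly (bigD1 a aG) /= (bigD1 (v |: a)) /=; last by apply/andP.
rewrite cardsU1 va exprS mulN1r addrA subrr add0r -[RHS]IH; apply: eq_bigl => s.
by rewrite in_setD in_set2 negb_or [RHS]andbC andbA.
Qed.

Lemma critical_euler (A : comNzRingType) G (Cr : {set {set S}}) n :
  Cr \subset G -> (forall s, s \in Cr -> #|s| = n) -> collapsible (G :\: Cr) ->
  fpoly G (-1 : A) = (-1) ^+ n * #|Cr|%:R.
Proof.
move=> CrG Crn /(collapsible_euler A) E.
rewrite /fpoly (big_setID Cr) /= [X in _ + X]E addr0 (setIidPr CrG).
rewrite (eq_bigr (fun=> (-1) ^+ n)) => [|s /Crn ->//].
by rewrite sumr_const mulr_natr.
Qed.

End Collapsible.

From mathcomp Require Import all_classical all_reals all_analysis homotopy.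
Import numFieldNormedType.Exports.

Local Open Scope classical_set_scope.
Local Open Scope ring_scope.

(** * Continuity, Hausdorff spaces and quotient maps *)

Section Continuity.
Context {R : realType} {T : topologicalType}.
Implicit Types f g : T -> R.

Lemma cst_cont (c : R) : continuous (fun _ : T => c).
Proof. by move=> x; apply: cvg_cst. Qed.

Lemma addr_cont f g : continuous f -> continuous g -> continuous (fun x => f x + g x).
Proof. by move=> cf cg x; apply: cvgD; [exact: cf|exact: cg]. Qed.

Lemma subr_cont f g : continuous f -> continuous g -> continuous (fun x => f x - g x).
Proof. by move=> cf cg x; apply: cvgB; [exact: cf|exact: cg]. Qed.

Lemma mulr_cont f g : continuous f -> continuous g -> continuous (fun x => f x * g x).
Proof. by move=> cf cg x; apply: cvgM; [exact: cf|exact: cg]. Qed.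

Lemma divr_cont f g : (forall x, g x != 0) ->
  continuous f -> continuous g -> continuous (fun x => f x / g x).
Proof.
by move=> g0 cf cg x; apply: cvgM; [exact: cf|apply: cvgV; [exact: g0|exact: cg]].
Qed.

Lemma minr_cont f g : continuous f -> continuous g ->
  continuous (fun x => Num.min (f x) (g x)).
Proof. by move=> cf cg x; apply: continuous_min; [exact: cf|exact: cg]. Qed.

Lemma maxr_cont f g : continuous f -> continuous g ->
  continuous (fun x => Num.max (f x) (g x)).
Proof. by move=> cf cg x; apply: continuous_max; [exact: cf|exact: cg]. Qed.

Lemma sumr_cont (I : Type) (r : seq I) (P : pred I) (F : I -> T -> R) :
  (forall i, P i -> continuous (F i)) -> continuous (fun x => \sum_(i <- r | P i) F i x).
Proof.
move=> cF; apply: (continuous_big (op := +%R)) => //.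
by move=> [a b]; apply: cvgD; [exact: cvg_fst|exact: cvg_snd].
Qed.

Lemma prodr_cont (I : Type) (r : seq I) (P : pred I) (F : I -> T -> R) :
  (forall i, P i -> continuous (F i)) -> continuous (fun x => \prod_(i <- r | P i) F i x).
Proof.
move=> cF; apply: (@continuous_big R I ( *%R) 1 P _ T r F) => //.
by move=> [a b]; apply: cvgM; [exact: cvg_fst|exact: cvg_snd].
Qed.

Lemma bigminr_cont (I : Type) (r : seq I) (P : pred I) (F : I -> T -> R) :
  (forall i, P i -> continuous (F i)) ->
  continuous (fun x => \big[Num.min/1]_(i <- r | P i) F i x).
Proof.
move=> cF; apply: (continuous_big (op := Num.min)) => //.
by move=> x; apply: continuous_min; [exact: cvg_fst|exact: cvg_snd].
Qed.

Lemma ptws_cont (I : choiceType) (f : T -> {ptws I -> R}) :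
  (forall i, continuous (fun x => f x i)) -> continuous f.
Proof.
move=> cf x; apply/cvg_sup => i A [_ [[V oV <-] /= Vfx VA]].
have := cf i x _ (open_nbhs_nbhs (conj oV Vfx)).
rewrite !nbhs_simpl/=. by apply: filterS => y Vy; apply: VA.
Qed.

Lemma mx_cont m n (f : T -> 'M[R]_(m, n)) :
  (forall i j, continuous (fun x => f x i j)) -> continuous f.
Proof.
move=> cf x A [B nB BA]; apply: (filterS (P := fun y => forall i j, B i j (f y i j))).
  by move=> y By; apply: BA.
apply: filter_forall => i; apply: filter_forall => j.
exact: (cf i j x _ (nB i j)).
Qed.

Lemma subtype_cont (X : topologicalType) (A : set X) (f : T -> A) :
  continuous (fun x => set_val (f x)) -> continuous f.
Proof. by move=> cf; apply/continuousP => _ [V oV <-]; move/continuousP: cf; exact. Qed.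

Lemma pair_cont (X Y : topologicalType) (f : T -> X) (g : T -> Y) :
  continuous f -> continuous g -> continuous (fun x => (f x, g x)).
Proof. by move=> cf cg x; apply: cvg_pair; [exact: cf|exact: cg]. Qed.

End Continuity.

Lemma set_val_cont (X : topologicalType) (A : set X) : continuous (set_val : A -> X).
Proof. exact: initial_continuous. Qed.

Lemma comp_cont (X Y Z : topologicalType) (f : X -> Y) (g : Y -> Z) :
  continuous f -> continuous g -> continuous (fun x => g (f x)).
Proof. by move=> cf cg x; apply: continuous_comp; [exact: cf|exact: cg]. Qed.

Lemma fst_cont (X Y : topologicalType) : continuous (fst : X * Y -> X).
Proof. by move=> x; exact: cvg_fst. Qed.

Lemma snd_cont (X Y : topologicalType) : continuous (snd : X * Y -> Y).
Proof. by move=> x; exact: cvg_snd. Qed.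

Lemma hausdorff_prod (X Y : topologicalType) :
  hausdorff_space X -> hausdorff_space Y -> hausdorff_space (X * Y)%type.
Proof.
move=> hX hY [a b] [c d] cl; congr pair.
  apply: hX => U V nU nV.
  have [z [Uz Vz]] := cl _ _ (@fst_cont X Y (a, b) _ nU) (@fst_cont X Y (c, d) _ nV).
  by exists z.1.
apply: hY => U V nU nV.
have [z [Uz Vz]] := cl _ _ (@snd_cont X Y (a, b) _ nU) (@snd_cont X Y (c, d) _ nV).
by exists z.2.
Qed.

Lemma hausdorff_subtype (X : topologicalType) (A : set X) :
  hausdorff_space X -> hausdorff_space A.
Proof.
move=> hX a b cl; apply: val_inj; apply: hX => U V nU nV.
have [z [Uz Vz]] := cl _ _ (@set_val_cont _ A a _ nU) (@set_val_cont _ A b _ nV).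
by exists (set_val z).
Qed.

Lemma compact_subtype (X : topologicalType) (A : set X) :
  compact A -> compact [set: A].
Proof.
move=> cA F PF _.
have [|p [Ap clp]] := cA (set_val @ F) _.
  rewrite nbhs_simpl/=. apply: (filterS _ (@filterT _ F _)) => x _. exact: set_valP.
exists (exist _ p (mem_set Ap)); split=> // U V FU [_ [[W oW <-] /= Wp WV]].
have FvU : (set_val @ F) (set_val @` U).
  by rewrite nbhs_simpl /=; apply: (filterS _ FU) => u Uu; exists u.
have [q [[u Uu <-] Wq]] := clp _ _ FvU (open_nbhs_nbhs (conj oW Wp)).
by exists u; split=> //; apply: WV.
Qed.

(* A continuous map from a compact set to a Hausdorff space is closed, hence a
   quotient map onto its image. *)
Lemma compact_factor (X W Y : topologicalType) (A : set X) (F : X -> W)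
    (K : X -> Y) (L : W -> Y) :
  compact A -> hausdorff_space W -> continuous F -> continuous K ->
  (forall x, A x -> L (F x) = K x) -> {within F @` A, continuous L}.
Proof.
move=> cA hW cF cK LF; apply/continuous_closedP => C cC.
(* Within the image of [A], the preimage of [C] under [L] is the image of a compact set, which is
   closed because [W] is Hausdorff. *)
apply/closed_subspaceP; exists (F @` (A `&` K @^-1` C)).
  apply: compact_closed => //; apply: continuous_compact.
    exact: continuous_subspaceT.
  apply: compact_closedI => //; move/continuous_closedP: cK; exact.
rewrite eqEsubset; split=> w /=.
  move=> [[x [Ax Cx] <-] _]; split; last by exists x.
  by rewrite /from_subspace LF.
move=> [Cw [x Ax Fx]]; split; last by exists x.
by exists x => //; split=> //; rewrite /= -LF // Fx.
Qed.

(** * Geometric realizations and their contraction along collapses *)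

Section Realization.
Context {R : realType} {S : finType}.
Implicit Types (G : {set {set S}}) (a b : {set S}) (t : {ptws S -> R}) (v : S).
Local Notation P := {ptws S -> R}.

Definition supp t : {set S} := [set v | t v != 0]%SET.

Lemma supp_eq0 t v : v \notin supp t -> t v = 0.
Proof. by rewrite inE negbK => /eqP. Qed.

Lemma realization_le1 G t v : geometric_realization R G t -> t v <= 1.
Proof. by move=> [t0 t1 _]; rewrite -t1 (bigD1 v) //= lerDl sumr_ge0. Qed.

Lemma realization_supp G t : geometric_realization R G t -> supp t \in G.
Proof. by case. Qed.

Lemma realizationW G G' t : supp t \in G' ->
  geometric_realization R G t -> geometric_realization R G' t.
Proof. by move=> tG' [t0 t1 _]. Qed.

Lemma realization_sum_supp G t a : supp t \subset a ->
  geometric_realization R G t -> \sum_(v in a) t v = 1.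
Proof.
move=> ta [_ t1 _]; rewrite -t1 [RHS](bigID (fun v =>
  v \in a)) /= [X in _ + X]big1 ?addr0 //.
by move=> v va; apply/supp_eq0/negP => /(fintype.subsetP ta); apply/negP.
Qed.

Lemma realization_closed G : face_closed G -> closed (geometric_realization R G).
Proof.
move=> Gcl.
(* The support condition becomes closed when written as the vanishing of the product of coordinates
   over each nonface. *)
have -> : geometric_realization R G = \bigcap_(v in [set: S]) [set t : P | 0 <= t v] `&`
    ([set t : P | \sum_v t v = 1] `&`
     \bigcap_(a in [set a | a \notin G]) [set t : P | \prod_(v in a) t v = 0]).
  rewrite eqEsubset; split=> t.
    move=> [t0 t1 tG]; split=> [v _ /=|]; first exact: t0.
    split=> // a /= aG; apply/eqP/negPn/negP => /prodf_neq0 pr.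
    by move/negP: aG; apply; apply: Gcl tG _; apply/fintype.subsetP => v /pr; rewrite inE.
  move=> [t0 [t1 tG]]; split=> // [v|]; first exact: t0.
  apply/negPn/negP => /tG /= /eqP; apply/negP/prodf_neq0 => v; by rewrite inE.
have cproj v : continuous (fun t : P => t v) by apply: proj_continuous.
apply: closedI; last apply: closedI.
- apply: closed_bigI => v _.
  exact: (continuous_closedP _).1 (cproj v) _ (@closed_ge R 0).
- have csum : continuous (fun t : P => \sum_v t v) by apply: sumr_cont.
  exact: (continuous_closedP _).1 csum _ (@closed_eq R 1).
- apply: closed_bigI => a _.
  have cprod : continuous (fun t : P => \prod_(v in a) t v) by apply: prodr_cont.
  exact: (continuous_closedP _).1 cprod _ (@closed_eq R 0).
Qed.

Lemma realization_compact G : face_closed G -> compact (geometric_realization R G).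
Proof.
move=> /realization_closed Gcl.
apply: (@subclosed_compact _ _ [set t : P | forall v, `[0, 1]%classic (t v)]) => //.
  by apply: (@tychonoff S (fun=> R) (fun=> `[0, 1]%classic)) => v; exact: segment_compact.
move=> t tG v /=; rewrite in_itv /= (realization_le1 _ tG) andbT.
by case: tG => t0 _ _; exact: t0.
Qed.

(** On the realization this is positive exactly where the support contains [a]. Coordinates there
    are at most 1, so the default value counts only for empty [a]. *)
Definition minon a t : R := \big[Num.min/1]_(v in a) t v.

Lemma minon_cont a : continuous (minon a : P -> R).
Proof. by apply: bigminr_cont => v _; apply: proj_continuous. Qed.

Lemma minon_le a t v : v \in a -> minon a t <= t v.
Proof. by move=> va; apply: bigmin_le_cond. Qed.

Lemma minon_ge0 a t : (forall v, 0 <= t v) -> 0 <= minon a t.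
Proof. by move=> t0; apply/bigmin_geP; split. Qed.

Lemma minon_attained a t v : (forall v, t v <= 1) -> v \in a ->
  exists2 w, w \in a & minon a t = t w.
Proof.
move=> t1 va; have [w wa wmin] := arg_minP (P := mem a) t va.
exists w => //; apply/le_anti; rewrite minon_le //=.
by apply/bigmin_geP; split.
Qed.

Lemma minon_gt0 G t a : geometric_realization R G t ->
  (0 < minon a t) = (a \subset supp t).
Proof.
move=> tG; have [t0 t1 _] := tG; apply/idP/fintype.subsetP => [m0 v va|ta].
  by rewrite inE gt_eqF // (lt_le_trans m0) // minon_le.
have [->|/set0Pn[v va]] := eqVneq a finset.set0; first by rewrite /minon big_set0.
have [w wa ->] := minon_attained (fun v => realization_le1 v tG) va.
by have := ta _ wa; rewrite inE lt0r t0 andbT.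
Qed.

Lemma minon_eq0 G t a : geometric_realization R G t ->
  (minon a t == 0) = ~~ (a \subset supp t).
Proof.
move=> tG; rewrite -(minon_gt0 _ tG) -leNgt eq_le minon_ge0 ?andbT //.
by case: tG.
Qed.

(** The retraction of the line onto the unit interval, through which homotopies accept any real
    time. *)
Definition clamp (s : R) : R := Num.max 0 (Num.min 1 s).

Lemma clamp_itv s : 0 <= clamp s <= 1.
Proof. by rewrite /clamp le_max lexx /= ge_max ler01 ge_min lexx. Qed.

Lemma clamp_le0 s : s <= 0 -> clamp s = 0.
Proof. by move=> s0; apply/max_idPl; rewrite ge_min s0 orbT. Qed.

Lemma clamp_ge1 s : 1 <= s -> clamp s = 1.
Proof. by move=> s1; rewrite /clamp (min_idPl s1); apply/max_idPr. Qed.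

Lemma clamp_id s : 0 <= s <= 1 -> clamp s = s.
Proof. by move=> /andP[s0 s1]; rewrite /clamp (min_idPr s1); apply/max_idPr. Qed.

Lemma clamp_cont (T : topologicalType) (f : T -> R) :
  continuous f -> continuous (fun x => clamp (f x)).
Proof.
by move=> cf; apply: maxr_cont; [exact: cst_cont|apply: minr_cont => //; exact: cst_cont].
Qed.

(* The time parameter ranges over the whole line and the maps are total, so that
   homotopies can be composed without gluing. *)
Definition contraction_to G (p : P) (H : P * R -> P) :=
  [/\ continuous H, forall t, H (t, 0) = t,
      forall t s, geometric_realization R G t -> geometric_realization R G (H (t, s)) &
      forall t, geometric_realization R G t -> H (t, 1) = p].

(* Pushes away from the free face [a] towards [v] at unit speed until the
   smallest coordinate on [a] vanishes. *)
Definition push a v (ts : P * R) : P := fun u =>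
  ts.1 u + ts.2 * minon a ts.1 * (if u == v then #|a|%:R else - (u \in a)%:R).

Lemma push_cont a v : continuous (push a v).
Proof.
have c1 := @fst_cont P R; have c2 := @snd_cont P R.
apply: ptws_cont => u; apply: addr_cont.
  by apply: (comp_cont c1 (g := fun t : P => t u)); apply: proj_continuous.
apply: mulr_cont; last exact: cst_cont.
by apply: mulr_cont => //; apply: (comp_cont c1); exact: minon_cont.
Qed.

Lemma push0 a v t : push a v (t, 0) = t.
Proof. by apply/funext => u; rewrite /push /= !mul0r addr0. Qed.

Lemma push_minon0 a v t s : minon a t = 0 -> push a v (t, s) = t.
Proof. by move=> m0; apply/funext => u; rewrite /push /= m0 mulr0 mul0r addr0. Qed.

Section FreePair.
Variables (G : {set {set S}}) (a : {set S}) (v : S).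
Hypotheses (Gcl : face_closed G) (va : v \notin a) (vaG : (v |: a)%SET \in G).
Hypothesis free : forall s, s \in G -> a \subset s -> s = a \/ s = (v |: a)%SET.

(** Where the push moves a point, freeness puts its support inside [v |: a]. The coordinates on [a]
    lose equal amounts, and [v] gains their sum. *)
Lemma push_realization t s : 0 <= s <= 1 -> geometric_realization R G t ->
  geometric_realization R G (push a v (t, s)).
Proof.
move=> /andP[s0 s1] tG; have [t0 t1 _] := tG; have tsG := realization_supp tG.
have m0 : 0 <= minon a t by apply: minon_ge0.
have := minon_eq0 a tG; case: eqVneq => [mE _|mN0 /esym/negbFE at_].
  by rewrite push_minon0.
have tva : supp t \subset v |: a.
  by case: (free tsG at_) => ->; rewrite // finset.subsetUr.
split=> [u||].
- rewrite /push /=; case: ifP => _.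
    by rewrite addr_ge0 // !mulr_ge0.
  case: (boolP (u \in a)) => ua; last by rewrite oppr0 mulr0 addr0.
  rewrite mulrN1 subr_ge0; apply: le_trans (minon_le _ ua).
  by rewrite ler_piMl.
- rewrite /push big_split /= t1 -big_distrr /= (bigD1 v) //= eqxx.
  rewrite (eq_bigr (fun u => - (u \in a)%:R)); last by move=> u /negbTE->.
  rewrite sumrN -natr_sum (_ : (\sum_(i | i != v) (i \in a))%N = #|a|).
    by rewrite subrr mulr0 addr0.
  rewrite -sum1_card big_mkcond [RHS]big_mkcond; apply: eq_bigr => u _.
  by case: eqVneq => [->|_]; [rewrite (negbTE va)|case: (u \in a)].
- apply: Gcl vaG _; apply/fintype.subsetP => u; rewrite !inE; apply: contraR.
  rewrite negb_or => /andP[uv ua];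
    rewrite /push /= (negbTE uv) (negbTE ua) oppr0 mulr0 addr0.
  by apply/eqP/supp_eq0; apply: contra ua => /(fintype.subsetP tva);
    rewrite !inE (negbTE uv).
Qed.

(** Either a coordinate on [a] vanishes already, or the push at time 1 brings the smallest one to
    zero; the new support cannot contain [a]. *)
Lemma push1_realization t : a != finset.set0 -> geometric_realization R G t ->
  geometric_realization R (G :\: [set a; v |: a])%SET (push a v (t, 1)).
Proof.
move=> /set0Pn[w wa] tG; have pG := push_realization (s := 1) _ tG.
rewrite lexx ler01 in pG; have {}pG := pG isT.
apply: realizationW (pG); rewrite finset.in_setD in_set2;
  rewrite (realization_supp pG) andbT.
suff : ~~ (a \subset supp (push a v (t, 1))).
  by apply: contra => /orP[]/eqP->; rewrite // finset.subsetUr.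
have := minon_eq0 a tG; case: eqVneq => [mE mt|_ _]; first by rewrite push_minon0 // -mt.
have [u ua mu] := minon_attained (fun v => realization_le1 v tG) wa.
apply/subsetPn; exists u => //; rewrite inE negbK /push /= mul1r mu ua.
by rewrite ifN ?mulrN1 ?subrr //; apply: contraNneq va => <-.
Qed.

End FreePair.

Lemma collapsible_contraction G : face_closed G -> collapsible G -> G != finset.set0 ->
  exists p H, contraction_to G p H /\ geometric_realization R G p.
Proof.
move=> + cG; elim: cG => [|{}G a v va aG vaG free _ IH] Gcl; first by rewrite eqxx.
(* If the free face is empty, the only faces are the empty one and [[set v]], and the realization is
   one point. *)
move=> _; have [a0|a0] := eqVneq a finset.set0.
  pose p : P := fun u => (u == v)%:R.
  have pE t : geometric_realization R G t -> t = p.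
    move=> tG; have [t0 t1 _] := tG; have tsG := realization_supp tG.
    have tv : supp t \subset [set v]%SET.
      by have := free _ tsG; rewrite a0 finset.sub0set finset.setU0 => /(_ isT)[]->;
        rewrite ?finset.sub0set.
    have tv1 : t v = 1 by have := realization_sum_supp tv tG; rewrite big_set1.
    apply/funext => u; rewrite /p; have [->//|uv] := eqVneq u v.
    by apply: supp_eq0; apply: contra uv => /(fintype.subsetP tv); rewrite inE.
  exists p, fst; split.
    by split; [exact: fst_cont| | |move=> t /pE].
  split=> [u||]; rewrite /p ?ler0n //.
    by rewrite (bigD1 v) //= eqxx big1 ?addr0 // => u /negbTE->.
  rewrite (_ : [set _ | _]%SET = v |: a) //; apply/setP => u.
  by rewrite a0 !inE orbF; case: (u == v); rewrite /= ?oner_eq0 ?eqxx.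
pose G' := (G :\: [set a; v |: a])%SET.
have G'sub : {subset G' <= G} by move=> s; rewrite inE => /andP[].
have G'cl : face_closed G'.
  move=> s t tG' st; have tG := G'sub _ tG'.
  rewrite finset.in_setD (Gcl _ _ tG st) andbT; apply: contraTN tG' => sa.
  rewrite finset.in_setD tG andbT negbK in_set2.
  have at_ : a \subset t.
    by apply: fintype.subset_trans st; move: sa; rewrite in_set2 => /orP[]/eqP->;
      rewrite ?finset.subsetUr.
  by case: (free _ tG at_) => ->; rewrite eqxx ?orbT.
have G'n0 : G' != finset.set0.
  apply/set0Pn; exists finset.set0;
    rewrite finset.in_setD in_set2 (Gcl _ _ aG (finset.sub0set _)) andbT.
  rewrite eq_sym (negbTE a0) /= eq_sym; apply/set0Pn; exists v; exact: setU11.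
have [p [H [[cH H0 HG H1] pG']]] := IH G'cl G'n0.
have subG t : geometric_realization R G' t -> geometric_realization R G t.
  by move=> tG; apply: realizationW (tG); apply: G'sub; case: tG.
(* The first half of the time is spent on the push, the second half on contracting the remaining
   complex. *)
exists p, (fun ts => H (push a v (ts.1, clamp (2 * ts.2)), clamp (2 * ts.2 - 1))).
split; last exact: subG.
have c1 := @fst_cont P R; have c2 := @snd_cont P R.
have c22 : continuous (fun ts : P * R => 2 * ts.2) by apply: mulr_cont => //;
  exact: cst_cont.
split=> [|t|t s tG|t tG] /=.
- apply: (comp_cont _ cH); apply: pair_cont.
    by apply: (comp_cont _ (@push_cont a v)); apply: pair_cont => //; exact: clamp_cont.
  by apply: clamp_cont; apply: subr_cont => //; exact: cst_cont.
- by rewrite mulr0 sub0r !clamp_le0 ?lerN10 // H0 push0.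
- have [s1|/ltW s1] := leP (2 * s) 1.
    by rewrite (clamp_le0 (s := _ - 1)) ?subr_le0 // H0; apply: push_realization => //;
      apply: clamp_itv.
  rewrite (clamp_ge1 s1); apply/subG/HG; exact: push1_realization.
- rewrite mulr1 (_ : 2 - 1 = 1) ?clamp_ge1 ?ler1n //;
  last by rewrite (_ : 2 = 1 + 1) ?addrK.
  by apply/H1; exact: push1_realization.
Qed.

End Realization.

(** * The map from a simplex to a sphere that collapses the boundary *)

Section SphereMap.
Context {R : realType} {S : finType} {n : nat}.
Variables (e : 'I_n.+1 -> S) (e_inj : injective e).
Local Notation P := {ptws S -> R}.
Implicit Types (t : P) (j : 'I_n.+1).

Definition simplex_face : {set S} := [set e j | j in 'I_n.+1]%SET.
Local Notation a := simplex_face.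

Lemma simplex_faceP j : e j \in a.
Proof. exact: imset_f. Qed.

Lemma sum_simplex_face (f : S -> R) : \sum_(v in a) f v = \sum_j f (e j).
Proof. by rewrite big_imset //= => i j _ _; exact: e_inj. Qed.

Lemma card_simplex_face : #|a| = n.+1.
Proof. by rewrite card_imset // card_ord. Qed.

Definition sph_den t : R := \sum_j (t (e j) - t (e ord0)) ^+ 2
  + minon a t ^+ 2 + (1 - \sum_j t (e j)) ^+ 2.

(* On the simplex spanned by [e], this is the inverse stereographic projection
   of [(t (e j) - t (e ord0)) / minon a t], which sends the boundary to the base
   point; the last square in [sph_den] keeps the denominator positive
   elsewhere. *)
Definition sph t : 'rV[R]_n.+1 := \row_j
  if j == ord0 then 1 - 2 * minon a t ^+ 2 / sph_den t
  else 2 * minon a t * (t (e j) - t (e ord0)) / sph_den t.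

(** If all the squares vanish, the coordinates along [e] are equal and have minimum 0, so their sum
    is 0 and not 1. *)
Lemma sph_den_gt0 t : 0 < sph_den t.
Proof.
have w0 : 0 <= \sum_j (t (e j) - t (e ord0)) ^+ 2 by apply: sumr_ge0 => j _;
  exact: sqr_ge0.
have m0 := sqr_ge0 (minon a t); have s0 := sqr_ge0 (1 - \sum_j t (e j)).
rewrite lt0r /sph_den !addr_ge0 // andbT.
rewrite !paddr_eq0 ?addr_ge0 // !sqrf_eq0;
  apply/negP => /andP[/andP[/eqP W /eqP M] /eqP D].
have tE j : t (e j) = t (e ord0).
  have : (t (e j) - t (e ord0)) ^+ 2 = 0.
    by apply: (psumr_eq0P _ W) => // i _; exact: sqr_ge0.
  by move/eqP; rewrite sqrf_eq0 subr_eq0 => /eqP.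
have t00 : t (e ord0) = 0.
  (* As [t] is arbitrary, [minon a t] may also be the default value 1, which is not zero. *)
  have [E|[v /imsetP[j _ ->] E]] : minon a t = 1 \/ exists2 v, v \in a & minon a t = t v.
  - rewrite /minon; elim/big_ind: _ => [|x y Hx Hy|v va]; first by left.
      by rewrite /Num.min; case: ifP.
    by right; exists v.
  - by move: M; rewrite E => /eqP; rewrite oner_eq0.
  - by rewrite -(tE j) -E.
by move/eqP: D; rewrite big1 ?subr0 ?oner_eq0 // => j _; rewrite tE.
Qed.

Lemma sph_cont : continuous (sph : P -> _).
Proof.
have ct v : continuous (fun t : P => t v) by apply: proj_continuous.
have cm := @minon_cont R S a.
have csq (f : P -> R) : continuous f -> continuous (fun t => f t ^+ 2).
  by move=> cf; exact: (mulr_cont cf cf).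
have c2 : continuous (fun _ : P => 2 : R) by apply: cst_cont.
have cd : continuous sph_den.
  apply: addr_cont; first apply: addr_cont; last by apply: csq; apply: subr_cont;
    [exact: cst_cont|apply: sumr_cont].
    by apply: sumr_cont => j _; apply: csq; apply: subr_cont.
  exact: csq.
have d0 t : sph_den t != 0 by rewrite gt_eqF // sph_den_gt0.
apply: mx_cont => i j.
rewrite (_ : (fun t : P => sph t i j) = fun t => if j == ord0
    then 1 - 2 * minon a t ^+ 2 / sph_den t
    else 2 * minon a t * (t (e j) - t (e ord0)) / sph_den t); last first.
  by apply/funext => t; rewrite mxE.
case: (j == ord0).
  apply: subr_cont; first exact: cst_cont.
  by apply: divr_cont => //; apply: mulr_cont => //; exact: csq.
by apply: divr_cont => //; apply: mulr_cont; [apply: mulr_cont|apply: subr_cont].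
Qed.

Lemma sph_base t : minon a t = 0 -> sph t = delta_mx 0 0.
Proof.
move=> m0; apply/rowP => j; rewrite !mxE m0 eqxx /=.
by case: ifP => _; rewrite ?expr0n /= ?mulr0 ?mul0r ?subr0.
Qed.

Lemma sph_unit t : minon a t = 0 \/ \sum_j t (e j) = 1 -> unit_sphere R n.+1 (sph t).
Proof.
move=> [/sph_base ->|t1]; first exact: unit_sphere_pole.
rewrite /unit_sphere /= (bigD1 ord0) //= mxE eqxx.
set m := minon a t; set E := sph_den t.
have EE : E = \sum_(j | j != ord0) (t (e j) - t (e ord0)) ^+ 2 + m ^+ 2.
  by rewrite /E /sph_den t1 subrr expr0n addr0 (bigD1 ord0) //= subrr expr0n add0r.
have E0 : E != 0 by rewrite gt_eqF // sph_den_gt0.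
rewrite (eq_bigr (fun j => (2 * m / E) ^+ 2 * (t (e j) - t (e ord0)) ^+ 2)); last first.
  by move=> j /negbTE j0; rewrite mxE j0 -exprMn mulrAC.
rewrite -big_distrr /=.
have -> : \sum_(j | j != ord0) (t (e j) - t (e ord0)) ^+ 2 = E - m ^+ 2 by rewrite EE addrK.
by field.
Qed.

Lemma sph_ne_base t : minon a t != 0 -> sph t != delta_mx 0 0.
Proof.
move=> m0; apply/negP => /eqP /rowP/(_ ord0); rewrite !mxE eqxx /= => /eqP.
rewrite eq_sym -subr_eq0 opprB addrC subrK mulf_eq0 invr_eq0 mulf_eq0 sqrf_eq0.
by rewrite (negbTE m0) pnatr_eq0 /= gt_eqF // sph_den_gt0.
Qed.

Lemma minon_simplex_face t : (forall v, t v <= 1) ->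
  exists2 j, minon a t = t (e j) & forall i, t (e j) <= t (e i).
Proof.
move=> t1; have [w /imsetP[j _ ->] mj] := minon_attained t1 (simplex_faceP ord0).
by exists j => // i; rewrite -mj minon_le // simplex_faceP.
Qed.

(** The image point determines the stereographic coordinates [y]. The coordinates of [t] are
    [minon a t * (1 - y i + y j)] with [y i] minimal, and the sum 1 fixes the factor. *)
Lemma sph_inj t t' : (forall v, t v <= 1) -> (forall v, t' v <= 1) ->
  0 < minon a t -> 0 < minon a t' ->
  \sum_j t (e j) = 1 -> \sum_j t' (e j) = 1 -> sph t = sph t' ->
  forall j, t (e j) = t' (e j).
Proof.
move=> t1 t1' m0 m0' s s' st.
pose y j := if j == ord0 then 0 else sph t 0 j / (1 - sph t 0 ord0).
have yE u : 0 < minon a u -> sph u = sph t -> forall j, u (e j) = u (e ord0) + minon a u * y j.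
  move=> mu0 us j; have E0 : sph_den u != 0 by rewrite gt_eqF // sph_den_gt0.
  rewrite /y -us !mxE eqxx; case: eqVneq => [->|_]; first by rewrite mulr0 addr0.
  by field; rewrite E0 subKr mulf_neq0 ?pnatr_eq0 // sqrf_eq0 gt_eqF.
have yP u : (forall v, u v <= 1) -> 0 < minon a u -> sph u = sph t ->
    exists2 i, forall j, y i <= y j & forall j, u (e j) = minon a u * (1 - y i + y j).
  move=> u1 mu0 us; have uE := yE u mu0 us.
  have [i ui imin] := minon_simplex_face u1; exists i => j.
    by have := imin j; rewrite uE [u (e j)]uE lerD2l ler_pM2l.
  have := uE i; rewrite -ui => mE; rewrite uE mulrDr mulrBr mulr1 {2}mE; ring.
have [i iy tE] := yP t t1 m0 erefl.
have [i' iy' tE'] := yP t' t1' m0' (esym st).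
have yi : y i' = y i by apply/le_anti; rewrite iy iy'.
rewrite yi in tE'.
have mm : minon a t = minon a t'.
  move: s s'; rewrite (eq_bigr _ (fun j _ => tE j)) (eq_bigr _ (fun j _ => tE' j)).
  rewrite -!big_distrr /= => s s'.
  have Q0 : \sum_j (1 - y i + y j) != 0.
    by apply/eqP => Q0; move/eqP: s; rewrite Q0 mulr0 eq_sym oner_eq0.
  by apply: (mulIf Q0); rewrite s s'.
by move=> j; rewrite tE tE' mm.
Qed.

Lemma sph_surj (z : 'rV[R]_n.+1) : unit_sphere R n.+1 z -> z != delta_mx 0 0 ->
  exists t, [/\ forall v, 0 <= t v, \sum_v t v = 1, supp t = a & sph t = z].
Proof.
move=> z1 zb; set z0 := z 0 ord0.
have z1E : \sum_(j | j != ord0) z 0 j ^+ 2 = 1 - z0 ^+ 2.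
  have z1' : \sum_i z 0 i ^+ 2 = 1 by [].
  by rewrite -z1' [in RHS](bigD1 ord0) //= addrAC subrr add0r.
have z0lt : z0 < 1.
  have sq_ge0 : 0 <= 1 - z0 ^+ 2 by rewrite -z1E sumr_ge0 // => j _; exact: sqr_ge0.
  (* Were [z0] equal to 1, all other coordinates would vanish and [z] would be the base point. *)
  rewrite lt_neqAle; apply/andP; split; last by nra.
  apply: contra zb => /eqP z0E; apply/eqP/rowP => j; rewrite mxE eqxx /=.
  have [->|j0] := eqVneq j ord0; first exact: z0E.
  have : z 0 j ^+ 2 = 0.
    apply: (psumr_eq0P (P := fun j => j != ord0) (F := fun j => z 0 j ^+ 2)) j0.
      by move=> k _; exact: sqr_ge0.
    by rewrite z1E z0E expr1n subrr.
  by move/eqP; rewrite sqrf_eq0 => /eqP.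
pose w j := if j == ord0 then 0 else z 0 j.
have [i _ wmin] := arg_minP (P := predT) w (isT : predT (ord0 : 'I_n.+1)).
(* This is [1 - z0] times the factor [1 - y i + y j] from [sph_inj]; division by the sum gives
   barycentric coordinates. *)
pose u j := 1 - z0 - w i + w j.
have u_ge j : 1 - z0 <= u j by rewrite /u -addrA lerDl addrC subr_ge0 wmin.
have u_gt0 j : 0 < u j by apply: lt_le_trans (u_ge j); rewrite subr_gt0.
have U_gt0 : 0 < \sum_j u j.
  by rewrite (bigD1 ord0) //= ltr_pwDl // sumr_ge0 // => j _; exact: ltW.
set c := (\sum_j u j)^-1; have c_gt0 : 0 < c by rewrite invr_gt0.
pose t : P := fun v => \sum_(j | e j == v) c * u j.
have tE j : t (e j) = c * u j.
  by rewrite /t (big_pred1 j) // => k /=; rewrite (inj_eq e_inj).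
have t_ge0 v : 0 <= t v by apply: sumr_ge0 => j _; rewrite mulr_ge0 ?ltW.
have t_out v : v \notin a -> t v = 0.
  move=> va; rewrite /t big_pred0 // => j; apply: contraNF va => /eqP <-.
  exact: simplex_faceP.
have tsum : \sum_j t (e j) = 1.
  by rewrite (eq_bigr _ (fun j _ => tE j)) -big_distrr /= mulVf ?gt_eqF.
have t1 : \sum_v t v = 1.
  rewrite (bigID (fun v => v \in a)) /= sum_simplex_face tsum big1 ?addr0 //.
have tle1 v : t v <= 1 by rewrite -t1 (bigD1 v) //= lerDl sumr_ge0.
have tsupp : supp t = a.
  apply/setP => v; rewrite inE; case: (boolP (v \in a)) => [/imsetP[j _ ->]|/t_out ->].
    by rewrite tE mulf_neq0 // gt_eqF.
  by rewrite eqxx.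
exists t; split=> //.
have mE : minon a t = c * (1 - z0).
  have [j -> jmin] := minon_simplex_face tle1.
  apply/le_anti/andP; split; last by rewrite tE ler_pM2l.
  by rewrite (le_trans (jmin i)) // tE /u subrK.
have wE j : t (e j) - t (e ord0) = c * w j.
  by rewrite !tE /u [in w ord0]/w eqxx addr0; ring.
have dE : sph_den t = c ^+ 2 * (2 * (1 - z0)).
  rewrite /sph_den tsum subrr expr0n addr0 mE.
  rewrite (eq_bigr (fun j => c ^+ 2 * w j ^+ 2)); last by move=> j _; rewrite wE exprMn.
  rewrite -big_distrr /= (bigD1 ord0) //= {1}/w eqxx expr0n add0r.
  rewrite (eq_bigr (fun j => z 0 j ^+ 2)); last by move=> j /negbTE j0; rewrite /w j0.
  by rewrite z1E; ring.
have z0N : 1 - z0 != 0 by rewrite gt_eqF // subr_gt0.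
have cN : c != 0 by rewrite gt_eqF.
apply/rowP => j; rewrite mxE dE mE; case: eqVneq => [->|j0].
  by rewrite -/z0; field; rewrite cN z0N.
rewrite wE {1}/w (negbTE j0); field; by rewrite cN z0N.
Qed.

End SphereMap.

(** * The homotopy equivalence with a wedge of spheres *)

Section WedgeEquivalence.
Context {R : realType} {S : finType} (G : {set {set S}}) {n k : nat}.
Variable e : 'I_k.+1 -> 'I_n.+1 -> S.
Local Notation P := {ptws S -> R}.
Local Notation A i := (simplex_face (e i)).
Hypotheses (Gcl : face_closed G) (e_inj : forall i, injective (e i)).
Hypothesis A_inj : injective (fun i => A i).
Hypotheses (AG : forall i, A i \in G) (Gsize : forall s, s \in G -> (#|s| <= n.+1)%N).
Local Notation G0 := (G :\: [set A i | i in 'I_k.+1])%SET.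
Variables (p : P) (H : P * R -> P).
Hypotheses (contr : contraction_to G0 p H) (pG0 : geometric_realization R G0 p).
Local Notation X := (geometric_realization R G).
Local Notation m i t := (minon (A i) t).
Local Notation base := (sphere_basepoint R n).
Local Notation W := (wedge (fun _ : 'I_k.+1 => base)).
Local Notation lift i z := (@wedge_lift _ _ (fun _ : 'I_k.+1 => base) i z).
Implicit Types (t : P) (i j : 'I_k.+1) (x y : X).

Let cardA i : #|A i| = n.+1.
Proof. exact: card_simplex_face. Qed.

Let lift_base i j : lift i base = lift j base.
Proof. exact: (@wedge_liftE _ _ (fun _ : 'I_k.+1 => base) j base i base). Qed.

(** Faces have at most [n.+1] vertices, so a face containing a critical one equals it. *)
Lemma supp_critical t i : X t -> 0 < m i t -> supp t = A i.
Proof.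
move=> tX; rewrite (minon_gt0 _ tX) => Ai; apply/esym/eqP.
by rewrite eqEcard Ai cardA Gsize // (realization_supp tX).
Qed.

Lemma minon_uniq t i j : X t -> 0 < m i t -> j != i -> m j t = 0.
Proof.
move=> tX mi ji; apply/eqP; rewrite (minon_eq0 _ tX) (supp_critical tX mi).
apply/negP => ss; move/negP: ji; apply; apply/eqP/A_inj/eqP.
by rewrite eqEcard ss !cardA /=.
Qed.

Lemma critical_or_G0 t : X t -> (exists i, 0 < m i t) \/ geometric_realization R G0 t.
Proof.
move=> tX; have [/existsP[i mi]|/existsPn noi] := boolP [exists i, 0 < m i t].
  by left; exists i.
right; apply: realizationW (tX); rewrite finset.in_setD (realization_supp tX) andbT.
by apply/imsetP => -[i _ sE]; have := noi i; rewrite (minon_gt0 _ tX) sE subxx.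
Qed.

Lemma realization_G0 t : geometric_realization R G0 t -> X t.
Proof.
move=> tG; apply: realizationW (tG).
by have := realization_supp tG; rewrite finset.in_setD => /andP[].
Qed.

Lemma minon_G0 t i : geometric_realization R G0 t -> m i t = 0.
Proof.
move=> tG; have tX := realization_G0 tG.
have := minon_ge0 (A i) (let: And3 t0 _ _ := tX in t0).
rewrite le0r => /orP[/eqP//|mi].
have := realization_supp tG; rewrite finset.in_setD (supp_critical tX mi).
by rewrite imset_f.
Qed.

Lemma realization_val x : X (set_val x).
Proof. exact: set_valP. Qed.

Lemma sph_unit_realization i t : X t -> unit_sphere R n.+1 (sph (e i) t).
Proof.
move=> tX; apply: sph_unit.
have := minon_ge0 (A i) (let: And3 t0 _ _ := tX in t0).
rewrite le0r => /orP[/eqP->|mi]; [by left|right].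
rewrite -sum_simplex_face //; have := realization_sum_supp _ tX; apply.
by rewrite (supp_critical tX mi).
Qed.

Definition sph_realization i x : unit_sphere R n.+1 :=
  SigSub (mem_set (sph_unit_realization i (realization_val x))).

Lemma sph_realization_cont i : continuous (sph_realization i).
Proof. by apply: subtype_cont; apply: (comp_cont (@set_val_cont _ X));
  exact: sph_cont. Qed.

Lemma sph_realization_base i x : m i (set_val x) = 0 -> sph_realization i x = base.
Proof. by move=> m0; apply: val_inj; exact: sph_base. Qed.

Lemma sph_realization_ne_base i x : 0 < m i (set_val x) -> sph_realization i x != base.
Proof.
move=> m0; apply/negP => /eqP/(congr1 set_val) sE.
have := @sph_ne_base R S n (e i) (set_val x); rewrite gt_eqF // => /(_ isT)/eqP; apply.
exact: sE.
Qed.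

(** At most one index qualifies, since open critical simplices are disjoint; the default is the base
    point. *)
Definition to_wedge x : W :=
  if [pick i | 0 < m i (set_val x)] is Some i then lift i (sph_realization i x) else lift ord0 base.

Lemma to_wedgeE x i : (forall j, j != i -> m j (set_val x) = 0) ->
  to_wedge x = lift i (sph_realization i x).
Proof.
move=> mj; rewrite /to_wedge; case: pickP => [j|no].
  by have [->//|/mj->] := eqVneq j i; rewrite ltxx.
rewrite sph_realization_base; first exact: lift_base.
apply/eqP; have := minon_ge0 (A i) (let: And3 t0 _ _ := realization_val x in t0).
by rewrite le0r no orbF.
Qed.

Lemma to_wedge_lift x : exists i, to_wedge x = lift i (sph_realization i x).
Proof.
have [[i mi]|xG] := critical_or_G0 (realization_val x); last first.
  by exists ord0; apply: to_wedgeE => j _; exact: minon_G0.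
by exists i; apply: to_wedgeE => j ji; exact: minon_uniq (realization_val x) mi ji.
Qed.

Lemma to_wedge_G0 x : geometric_realization R G0 (set_val x) -> to_wedge x = lift ord0 base.
Proof.
move=> xG; rewrite (@to_wedgeE x ord0); last by move=> j _; exact: minon_G0.
by rewrite sph_realization_base //; exact: minon_G0.
Qed.

(** Near a point of an open critical simplex only one lift is involved. At a point of [G0], a
    neighbourhood of the wedge point restricts to one of the base point in each of the finitely many
    spheres. *)
Lemma to_wedge_cont : continuous to_wedge.
Proof.
move=> x; have [[i mi]|xG] := critical_or_G0 (realization_val x).
  rewrite /continuous_at (@to_wedgeE x i); last by move=> j ji;
    exact: minon_uniq (realization_val x) mi ji.
  have cl : continuous (fun y => lift i (sph_realization i y)).
    by apply: (comp_cont (@sph_realization_cont i));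
      exact: (@wedge_lift_continuous _ _ (fun _ : 'I_k.+1 => base) i).
  have cm : continuous (fun y : X => m i (set_val y)).
    by apply: (comp_cont (@set_val_cont _ X)); exact: minon_cont.
  move=> U nU; have := cl x _ nU; have := cm x _ (lt_nbhsr mi).
  rewrite !nbhs_simpl /=; apply: filterS2 => y my Uy.
  rewrite /= (@to_wedgeE y i) // => j ji; exact: minon_uniq (realization_val y) my ji.
rewrite /continuous_at to_wedge_G0 // => U; rewrite wedge_point_nbhs => nU.
have Ui i : nbhs x (fun y => U (lift i (sph_realization i y))).
  have nUi : nbhs (sph_realization i x) (fun z => U (lift i z)).
    by rewrite sph_realization_base ?minon_G0 //; exact: nU.
  by have := @sph_realization_cont i x _ nUi; rewrite nbhs_simpl.
have FF : Filter (nbhs x) by exact: nbhs_filter.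
have := filter_forall FF Ui.
rewrite !nbhs_simpl /=; apply: filterS => y Uy; rewrite /=;
  have [i ->] := to_wedge_lift y.
exact: Uy.
Qed.

(** Compares the coordinates of both sides in the product of the spheres. *)
Lemma wedge_lift_eq i j (z z' : unit_sphere R n.+1) :
  lift i z = lift j z' -> if i == j then z = z' else z = base.
Proof.
move=> /(congr1 (@wedge_prod _ _ _)); rewrite /wedge_prod.
rewrite !wedge_lift_funE; [|exact: wedge_prod_pointE..].
move=> /(congr1 (fun F => F i)); rewrite dfwithin.
have [<-|ij] := eqVneq i j; first by rewrite dfwithin.
by rewrite dfwithout // eq_sym.
Qed.

(** [sph_inj] separates the points of an open critical simplex, and their images avoid the base
    point. *)
Lemma to_wedge_inj x y : to_wedge x = to_wedge y -> x = y \/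
  (geometric_realization R G0 (set_val x) /\ geometric_realization R G0 (set_val y)).
Proof.
have crit u i : 0 < m i (set_val u) -> to_wedge u = lift i (sph_realization i u).
  by move=> mi; apply: to_wedgeE => j ji; exact: minon_uniq (realization_val u) mi ji.
have one u v : (exists i, 0 < m i (set_val u)) ->
    geometric_realization R G0 (set_val v) -> to_wedge u <> to_wedge v.
  move=> [i mi] vG; rewrite (crit _ _ mi) (to_wedge_G0 vG) (lift_base ord0 i).
  by move=> /wedge_lift_eq; rewrite eqxx; apply/eqP/sph_realization_ne_base.
have [xc|xG] := critical_or_G0 (realization_val x);
  have [yc|yG] := critical_or_G0 (realization_val y).
- case: xc yc => [i mi] [j mj]; rewrite (crit _ _ mi) (crit _ _ mj) => /wedge_lift_eq.
  case: eqVneq => [ij|_]; last by move/eqP; rewrite (negbTE (sph_realization_ne_base mi)).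
  rewrite -{}ij in mj * => sE; left; apply: val_inj; apply/funext => v.
  have sx := supp_critical (realization_val x) mi;
    have sy := supp_critical (realization_val y) mj.
  have [/imsetP[l _ ->]|vA] := boolP (v \in A i); last first.
    by rewrite !supp_eq0 // ?sx ?sy.
  apply: (@sph_inj R S n (e i)) => //.
  + by move=> u; exact: realization_le1 (realization_val x).
  + by move=> u; exact: realization_le1 (realization_val y).
  + by rewrite -sum_simplex_face //; apply: realization_sum_supp (realization_val x);
    rewrite sx.
  + by rewrite -sum_simplex_face //; apply: realization_sum_supp (realization_val y);
    rewrite sy.
  + exact: (congr1 set_val sE).
- by move/(one _ _ xc yG).
- by move/esym/(one _ _ yc xG).
- by right.
Qed.

(** [sph_surj] reaches everything but the base point, which is the image of [p]. *)
Lemma to_wedge_surj (w : W) : exists x, to_wedge x = w.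
Proof.
have : [set: W] w by []; rewrite -wedgeTE => -[i _ [z _ <-]].
have [->|zb] := eqVneq z base.
  by exists (SigSub (mem_set (realization_G0 pG0))); rewrite to_wedge_G0 //.
have [|t [t0 t1 ts tz]] := sph_surj (e_inj (i := i)) (set_valP z).
  by apply: contra zb => /eqP zE; apply/eqP/val_inj.
have tX : X t by split=> //; rewrite -/(supp t) ts.
exists (SigSub (mem_set tX)); rewrite (to_wedgeE (i := i)).
  by congr (lift i _); apply: val_inj.
by move=> j ji; apply: (minon_uniq tX) ji; rewrite (minon_gt0 _ tX) ts.
Qed.

Local Notation N := (n.+1%:R : R).

(** On a critical simplex [enlarge] maps [t] to [(t - l) / (1 - N * l)] with this [l]. The bound by
    [m i] keeps the coordinates nonnegative, the other one keeps the denominator at least one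
    half. *)
Definition shrink_by i (ts : P * R) : R := Num.min (m i ts.1) (clamp ts.2 / (2 * N)).

(* Enlarges the points near the boundary of each critical simplex radially from
   its barycenter, reaching the boundary where the minimal coordinate is at most
   [s / 2N]. *)
Definition enlarge (ts : P * R) : P := fun v => ts.1 v +
  \sum_i shrink_by i ts / (1 - N * shrink_by i ts) * ((N * ts.1 v - 1) * (v \in A i)%:R).

(** On the realization this is positive only where [enlarge] has already reached [G0], so [H] moves
    points of [G0] only. *)
Definition collapse_time (ts : P * R) : R :=
  clamp (clamp ts.2 - 2 * N * \sum_i m i ts.1).

Definition collapse (ts : P * R) : P := H (enlarge ts, collapse_time ts).

Let N_gt0 : 0 < N.
Proof. by rewrite ltr0n. Qed.

Lemma shrink_by_lt i ts : 0 < 1 - N * shrink_by i ts.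
Proof.
have N0 := N_gt0; have /andP[s0 s1] := clamp_itv ts.2.
have : shrink_by i ts <= clamp ts.2 / (2 * N) by rewrite /shrink_by ge_min lexx orbT.
rewrite ler_pdivlMr ?mulr_gt0 //; nra.
Qed.

Lemma collapse_cont : continuous collapse.
Proof.
have [cH _ _ _] := contr.
have c1 := @fst_cont P R; have c2 := @snd_cont P R.
have cm i : continuous (fun ts : P * R => m i ts.1).
  by apply: (comp_cont c1); exact: minon_cont.
have ct v : continuous (fun ts : P * R => ts.1 v).
  by apply: (comp_cont c1 (g := fun t : P => t v)); apply: proj_continuous.
have cs : continuous (fun ts : P * R => clamp ts.2) by exact: clamp_cont.
have csh i : continuous (shrink_by i).
  by apply: minr_cont => //; apply: mulr_cont => //; exact: cst_cont.
have cN : continuous (fun _ : P * R => N) by exact: cst_cont.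
have cone : continuous (fun _ : P * R => 1 : R) by exact: cst_cont.
apply: (comp_cont _ cH); apply: pair_cont.
  apply: ptws_cont => v; apply: addr_cont => //; apply: sumr_cont => i _.
  apply: mulr_cont.
    apply: divr_cont => // [ts|]; first by rewrite gt_eqF // shrink_by_lt.
    by apply: subr_cont => //; exact: mulr_cont.
  apply: mulr_cont; last exact: cst_cont.
  by apply: subr_cont => //; exact: mulr_cont.
apply: clamp_cont; apply: subr_cont => //; apply: mulr_cont; first exact: cst_cont.
by apply: sumr_cont.
Qed.

Lemma shrink_by0 i t s : m i t = 0 -> shrink_by i (t, s) = 0.
Proof.
move=> m0; rewrite /shrink_by /= m0; apply/min_idPl.
by have /andP[s0 _] := clamp_itv s; rewrite divr_ge0 // mulr_ge0.
Qed.

Lemma collapse_G0 t s : geometric_realization R G0 t -> collapse (t, s) = H (t, clamp s).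
Proof.
move=> tG; rewrite /collapse; congr (H (_, _)).
  apply/funext => v; rewrite /enlarge big1 ?addr0 // => i _.
  by rewrite shrink_by0 ?mul0r // minon_G0.
rewrite /collapse_time big1 ?mulr0 ?subr0 /= => [|i _]; last exact: minon_G0.
by rewrite clamp_id // clamp_itv.
Qed.

Lemma collapse0 t : X t -> collapse (t, 0) = t.
Proof.
have [_ H0 _ _] := contr; move=> tX; have [t0 _ _] := tX.
rewrite /collapse (_ : collapse_time _ = 0).
  rewrite H0; apply/funext => v; rewrite /enlarge big1 ?addr0 // => i _.
  rewrite /shrink_by /= clamp_le0 // mul0r (min_idPr _) ?mul0r //.
  exact: minon_ge0.
rewrite /collapse_time /= (clamp_le0 (lexx 0)) clamp_le0 // sub0r oppr_le0.
by rewrite !mulr_ge0 // sumr_ge0 // => i _; exact: minon_ge0.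
Qed.

Lemma collapse1 t : geometric_realization R G0 t -> collapse (t, 1) = p.
Proof.
have [_ _ _ H1] := contr.
by move=> tG; rewrite collapse_G0 // clamp_ge1 //; exact: H1.
Qed.

Lemma collapse_realization_G0 t s : geometric_realization R G0 t ->
  geometric_realization R G0 (collapse (t, s)).
Proof. by have [_ _ HG _] := contr; move=> tG; rewrite collapse_G0 //; exact: HG. Qed.

Lemma collapse_realization t s : X t -> X (collapse (t, s)).
Proof.
move=> tX; have [t0 t1 _] := tX; have [_ H0 HG _] := contr; have N0 := N_gt0.
have [[i mi]|tG] := critical_or_G0 tX; last first.
  by apply: realization_G0; exact: collapse_realization_G0.
have mj j : j != i -> m j t = 0 by move=> ji; exact: (minon_uniq tX mi).
have st := supp_critical tX mi.
set l := shrink_by i (t, s); have l_lt : 0 < 1 - N * l by exact: shrink_by_lt.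
have l_ge0 : 0 <= l.
  have /andP[s0 _] := clamp_itv s.
  by rewrite /l /shrink_by le_min minon_ge0 //= divr_ge0 // mulr_ge0.
have l_le : l <= m i t by rewrite /l /shrink_by ge_min lexx.
have eE v : enlarge (t, s) v = if v \in A i then (t v - l) / (1 - N * l) else 0.
  rewrite /enlarge (bigD1 i) //= big1 ?addr0 => [|j ji]; last first.
    by rewrite shrink_by0 ?mul0r // mj.
  rewrite -/l; case: ifP => vA; last by rewrite !mulr0 addr0 supp_eq0 // st vA.
  by rewrite /= mulr1; field; rewrite nat1r gt_eqF.
have eX : X (enlarge (t, s)).
  split=> [v||].
  - rewrite eE; case: ifP => // vA; apply: divr_ge0; last exact: ltW.
    by rewrite subr_ge0 (le_trans l_le) // minon_le.
  - under eq_bigr do rewrite eE.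
    rewrite -big_mkcond /= -big_distrl /= sumrB sumr_const cardA.
    rewrite (realization_sum_supp _ tX) ?st //.
    rewrite -(mulr_natl l) divff //.
    by rewrite gt_eqF.
  - apply: Gcl (AG i) _; apply/fintype.subsetP => v; rewrite inE eE.
    by case: ifP => //; rewrite eqxx.
have tmE : collapse_time (t, s) = clamp (clamp s - 2 * N * m i t).
  by rewrite /collapse_time (bigD1 i) //= big1 ?addr0.
rewrite /collapse; have [le0|gt0] := leP (clamp s - 2 * N * m i t) 0.
  by rewrite tmE clamp_le0 // H0.
apply/realization_G0/HG; apply: realizationW (eX).
(* Positive contraction time makes [m i t] the smaller term in [shrink_by], so [enlarge] brings a
   coordinate to zero; the new support is too small to be critical. *)
have lE : l = m i t.
  rewrite /l /shrink_by; apply/min_idPl.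
  by rewrite ler_pdivlMr ?mulr_gt0 //= mulrC -subr_ge0 ltW.
have [j mjE _] := minon_simplex_face (e i) (fun v => realization_le1 v tX).
rewrite finset.in_setD (realization_supp eX) andbT; apply/imsetP => -[j' _ sE].
have : supp (enlarge (t, s)) \proper A i.
  rewrite properE; apply/andP; split.
    by apply/fintype.subsetP => v; rewrite inE eE; case: ifP => //; rewrite eqxx.
  apply/subsetPn; exists (e i j); first exact: simplex_faceP.
  by rewrite inE eE simplex_faceP lE mjE subrr mul0r eqxx.
by move/proper_card; rewrite sE !cardA ltnn.
Qed.

(** Time is reversed, so that the homotopy ends at the identity. *)
Definition collapse_map (xs : X * R) : X :=
  SigSub (mem_set (collapse_realization (1 - xs.2) (realization_val xs.1))).

Lemma collapse_map_cont : continuous collapse_map.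
Proof.
apply: subtype_cont; apply: (comp_cont _ collapse_cont); apply: pair_cont.
  by apply: (comp_cont (@fst_cont X R)); exact: set_val_cont.
by apply: subr_cont; [exact: cst_cont|exact: snd_cont].
Qed.

(** The section [sec] need not be continuous. As [collapse_map] preserves [G0], its composite with
    [to_wedge] is constant on the fibres of [to_wedge] at all times; at time 0 so is [collapse_map]
    itself, which sends [G0] to [p]. Continuity then follows from [compact_factor]. *)
Lemma homotopy_equivalent_wedge : homotopy_equivalent R X W.
Proof.
have [sec secK] := choice to_wedge_surj.
have hW : hausdorff_space W.
  by apply: wedge_hausdorff => i; apply: hausdorff_subtype; exact: norm_hausdorff.
have cX : compact [set: X] by apply: compact_subtype; exact: realization_compact.
have col_G0 z s : geometric_realization R G0 (set_val z) ->
    to_wedge (collapse_map (z, s)) = lift ord0 base.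
  move=> zG; apply: to_wedge_G0; exact: (collapse_realization_G0 (1 - s) zG).
have sec_fix x s : to_wedge (collapse_map (sec (to_wedge x), s)) = to_wedge (collapse_map (x, s)).
  have [->//|[xG yG]] := to_wedge_inj (secK (to_wedge x)).
  by rewrite (col_G0 _ _ xG) (col_G0 _ _ yG).
have sec_fix0 x : collapse_map (sec (to_wedge x), 0) = collapse_map (x, 0).
  have [->//|[xG yG]] := to_wedge_inj (secK (to_wedge x)).
  by apply: val_inj; rewrite /= subr0 !collapse1.
have collapse_map1 x : collapse_map (x, 1) = x.
  by apply: val_inj; rewrite /= subrr collapse0 //; exact: realization_val.
exists to_wedge, (fun w => collapse_map (sec w, 0)); split.
- exact: to_wedge_cont.
- apply/continuous_subspace_setT.
  have := @compact_factor X W X setT to_wedge (fun x => collapse_map (x, 0))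
    (fun w => collapse_map (sec w, 0)) cX hW to_wedge_cont.
  rewrite (_ : to_wedge @` setT = setT).
    apply=> [|x _]; last exact: sec_fix0.
    by apply: (comp_cont _ collapse_map_cont); apply: pair_cont;
      [move=> x|exact: cst_cont].
  by rewrite eqEsubset; split=> w // _; exists (sec w).
- exists collapse_map; split=> [|x|x].
  + exact/continuous_subspaceT/collapse_map_cont.
  + by rewrite /= sec_fix0.
  + by rewrite collapse_map1.
- exists (fun ws => to_wedge (collapse_map (sec ws.1, ws.2))); split=> [|w|w] //=;
  last first.
    by rewrite collapse_map1 secK.
  (* Here the quotient map is [to_wedge] times the identity of the unit interval, with compact
     source. *)
  have := @compact_factor (X * R)%type (W * R)%type W (setT `*` `[0, 1])
    (fun xs => (to_wedge xs.1, xs.2)) (fun xs => to_wedge (collapse_map xs))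
    (fun ws => to_wedge (collapse_map (sec ws.1, ws.2))).
  rewrite (_ : [set (to_wedge xs.1, xs.2) | xs in setT `*` `[0, 1]] = setT `*` `[0, 1]).
    apply.
    + by apply: compact_setX => //; exact: segment_compact.
    + by apply: hausdorff_prod => //; exact: norm_hausdorff.
    + apply: pair_cont; last exact: snd_cont.
      by apply: (comp_cont (@fst_cont X R)); exact: to_wedge_cont.
    + by apply: (comp_cont collapse_map_cont); exact: to_wedge_cont.
    + by move=> [x s] _; exact: sec_fix.
  rewrite eqEsubset; split=> [_ [[x s] [_ s01] <-]//|[w s] [_ s01]].
  by exists (sec w, s); rewrite //= secK.
Qed.

End WedgeEquivalence.

(** * From critical faces to wedges of spheres *)

Lemma realization_contractible (R : realType) (S : finType) (G : {set {set S}}) :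
  face_closed G -> collapsible G -> G != finset.set0 ->
  homotopy_equivalent R (geometric_realization R G) 'rV[R]_0.
Proof.
move=> Gcl cG Gn0.
have [p [H [[cH H0 HG H1] pG]]] := @collapsible_contraction R S G Gcl cG Gn0.
pose X := geometric_realization R G.
pose HX (xs : X * R) : X := SigSub (mem_set (HG _ (1 - xs.2) (set_valP xs.1))).
exists (fun=> 0), (fun=> SigSub (mem_set pG) : X); split.
- exact: cst_continuous.
- exact: cst_continuous.
- exists HX; split=> [|x|x].
  + apply: continuous_subspaceT; apply: subtype_cont; apply: (comp_cont _ cH).
    apply: pair_cont; first by apply: (comp_cont (@fst_cont X R)); exact: set_val_cont.
    by apply: subr_cont; [exact: cst_cont|exact: snd_cont].
  + by apply: val_inj; rewrite /= subr0 H1 //; exact: set_valP.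
  + by apply: val_inj; rewrite /= subrr H0.
- exists (fun ws => ws.1); split=> [|x|x] //.
    by apply: continuous_subspaceT => ws; exact: fst_cont.
  by apply/rowP => -[].
Qed.

Lemma critical_homotopy (R : realType) (S : finType) (G Cr : {set {set S}}) n :
  face_closed G -> G != finset.set0 -> (forall s, s \in G -> (#|s| <= n)%N) ->
  Cr \subset G -> (forall s, s \in Cr -> #|s| = n) -> collapsible (G :\: Cr)%SET ->
  htpy_wedge_of_spheres R (geometric_realization R G) #|Cr| n.
Proof.
move=> Gcl Gn0 Gsize CrG Crn cG.
have G0 : finset.set0 \in G.
  by have /set0Pn[s sG] := Gn0; apply: Gcl sG (finset.sub0set _).
move Ek : #|Cr| => [|k].
  move: cG; rewrite (cards0_eq Ek) finset.setD0 => cG.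
  exact: realization_contractible.
case: n => [|n] in Gsize Crn *.
  (* For [n = 0] the only face is the empty one, so [Cr] has one element; the realization and the
     sphere are both empty, since an empty sum is not 1. *)
  have GE s : s \in G -> s = finset.set0 by move=> /Gsize;
    rewrite leqn0 => /eqP/cards0_eq.
  split.
    have : (#|Cr| <= 1)%N.
      apply: (@leq_trans #|[set finset.set0 : {set S}]%SET|); last by rewrite cards1.
      apply: subset_leq_card; apply/fintype.subsetP => s /(fintype.subsetP CrG)/GE ->.
      by rewrite inE.
    by rewrite Ek; case: (k).
  have noX (x : geometric_realization R G) : False.
    have xG := set_valP x; have := realization_sum_supp (fintype.subxx _) xG.
    rewrite (GE _ (realization_supp xG)) big_set0 => /eqP.
    by rewrite eq_sym oner_eq0.
  have noS (z : unit_sphere R 0) : False.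
    have : \sum_(i < 0) (set_val z : 'rV[R]_0) 0 i ^+ 2 = 1 := set_valP z.
    by rewrite big_ord0 => /eqP; rewrite eq_sym oner_eq0.
  exists (fun x => False_rect _ (noX x)), (fun z => False_rect _ (noS z)).
  split=> [x|z||]; [by case: (noX x)|by case: (noS z)| |].
    by exists (fun xs => xs.1); split=> [|x|x]; [|case: (noX x)..] => xs;
      case: (noX xs.1).
  by exists (fun xs => xs.1); split=> [|x|x]; [|case: (noS x)..] => xs; case: (noS xs.1).
pose F (i : 'I_k.+1) : {set S} := enum_val (cast_ord (esym Ek) i).
have FCr i : F i \in Cr by exact: enum_valP.
have eP i : {f : 'I_n.+1 -> S | injective f & simplex_face f = F i}.
  have Fn : #|F i| = n.+1 := Crn _ (FCr i).
  have f_inj : injective (fun j => enum_val (cast_ord (esym Fn) j)).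
    by move=> j j' /enum_val_inj/cast_ord_inj.
  exists (fun j => enum_val (cast_ord (esym Fn) j)) => //.
  apply/eqP; rewrite eqEcard (card_simplex_face f_inj); apply/andP; split;
    last by rewrite Fn.
  by apply/fintype.subsetP => _ /imsetP[j _ ->]; exact: enum_valP.
pose e i := s2val (eP i).
have e_inj i : injective (e i) := s2valP (eP i).
have eF i : simplex_face (e i) = F i := s2valP' (eP i).
have CrE : [set simplex_face (e i) | i in 'I_k.+1]%SET = Cr.
  apply/setP => s; apply/imsetP/idP => [[i _ ->]|sCr]; first by rewrite eF.
  exists (cast_ord Ek (enum_rank_in sCr s)) => //.
  by rewrite eF /F cast_ordK enum_rankK_in.
have [||p [H [contr pG]]] := @collapsible_contraction R S (G :\: Cr)%SET _ cG.
(* Critical faces have maximal size, so the complex stays closed when they are removed. *)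
- move=> s t /finset.setDP[tG tCr] st; rewrite finset.in_setD (Gcl _ _ tG st) andbT.
  apply: contra tCr => sCr; suff -> : t = s by [].
  by apply/esym/eqP; rewrite eqEcard st (Crn _ sCr) Gsize.
- apply/set0Pn; exists finset.set0; rewrite finset.in_setD G0 andbT.
  by apply/negP => /Crn; rewrite cards0.
rewrite -CrE in contr pG.
apply: (homotopy_equivalent_wedge (e := e)) contr pG => //.
- move=> i j; rewrite !eF => /enum_val_inj/cast_ord_inj; exact.
- by move=> i; rewrite eF; apply: (fintype.subsetP CrG).
Qed.

Theorem theorem4p1 (R : realType) (disp : Order.disp_t)
    (S : finOrderType disp) (C : semimatroid S) :
  [/\ vertex_decomposable (BC C),
      forall (F : fieldType) (q : F), q != 0 ->
        fpoly (BC C) q = q ^+ rank C * tutte C ((q + 1) / q) 0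
    & exists2 k : nat, k%:Z = tutte C (0 : int) 0 &
        complex_htpy_wedge_of_spheres R (BC C) k (rank C)].
Proof.
split; [exact: vd_BC|by move=> F q; exact: fpoly_BC_tutte|].
have [Cr [CrG Crn cC]] := vd_collapsible (vd_BC C).
(* Both evaluations of the face polynomial at -1 carry this sign, which cancels over the
   integers. *)
have sgn (a b : int) : (-1) ^+ rank C * a = (-1) ^+ rank C * b -> a = b.
  by apply: mulfI; rewrite signr_eq0.
have euler := fpoly_BC_N1 int C.
(* For the void complex the face polynomial is zero, hence so is the Tutte value; otherwise [k]
   counts the critical faces. *)
have [BC0|BCn0] := eqVneq (BC C) finset.set0.
  exists 0%N; last by rewrite /complex_htpy_wedge_of_spheres BC0 eqxx.
  by apply: sgn; rewrite -euler BC0 /fpoly big_set0 mulr0.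
rewrite csize_BC // in Crn.
exists #|Cr|.
  by apply: sgn; rewrite -euler (critical_euler int CrG Crn cC) natz.
rewrite /complex_htpy_wedge_of_spheres (negbTE BCn0).
apply: critical_homotopy CrG Crn cC => //; first exact: BC_closed.
by move=> s; exact: BC_card_le.
Qed.
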